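(* There exists a (nonzero) family of linear operators $\mathcal{R}_2=\mathcal{R}_2(u_1,u_2|v_2,v_3)$ on $\mathbb{C}[x_1,y_1,z_1,x_2,y_2,z_2]$, depending only on $u_1,u_2,v_2,v_3$ (not on $u_3,v_1$) and satisfying $$\mathcal{R}_2(u_1,u_2|v_2,v_3)=\mathcal{R}_2(u_1+\lambda,u_2+\lambda|v_2+\lambda,v_3+\lambda)\quad\text{for all }\lambda\in\mathbb{C},$$ which solves, for all generic parameters, the defining equations $$\mathcal{R}_{2}\,\mathrm{L}_{1}(u_1,u_2,u_3)\,\mathrm{L}_{2}(v_1,v_2,v_3)=\mathrm{L}_{1}(u_1,v_2,u_3)\,\mathrm{L}_{2}(v_1,u_2,v_3)\,\mathcal{R}_{2}.$$ These requirements fix $\mathcal{R}_2$ up to an overall normalization constant (a scalar, which may depend on the parameters): up to such a factor, $$\mathcal{R}_2\sim S_2^{-1}\cdot\frac{\Gamma(z_2\partial_{z_2}+u_2-v_3+1)}{\Gamma(z_2\partial_{z_2}+1)}\cdot e^{\frac{y_1}{z_2}\partial_{x_1}}\cdot\frac{\Gamma(x_1\partial_{x_1}+u_1-v_2+1)}{\Gamma(x_1\partial_{x_1}+u_1-u_2+1)}\cdot e^{-\frac{y_1}{z_2}\partial_{x_1}}\cdot\frac{\Gamma(z_2\partial_{z_2}+1)}{\Gamma(z_2\partial_{z_2}+v_2-v_3+1)}\cdot S_2,$$ where $$S_2=e^{(y_2-x_1z_1)\partial_{y_1}}\cdot e^{z_1\partial_{z_2}}\cdot e^{x_2\partial_{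x_1}}.$$
   Context: For complex parameters $a_1,a_2,a_3$ and $k\in\{1,2\}$ the $s\ell(3)$ Lax operator is the $3\times3$ matrix of differential operators $$\mathrm{L}_k(a_1,a_2,a_3)=\begin{pmatrix}1&0&0\\ -x_k&1&0\\ -y_k&-z_k&1\end{pmatrix}\begin{pmatrix}a_1&\partial_{x_k}-z_k\partial_{y_k}&\partial_{y_k}\\ 0&a_2&\partial_{z_k}\\ 0&0&a_3\end{pmatrix}\begin{pmatrix}1&0&0\\ x_k&1&0\\ y_k+x_kz_k&z_k&1\end{pmatrix}$$ acting on $\mathbb{C}[x_1,y_1,z_1,x_2,y_2,z_2]$, where products are matrix products with (noncommuting) operator entries. An operator placed to the left or right of a matrix composes with each entry from that side. Parameters are complex and generic: no pairwise difference of $u_1,u_2,u_3,v_1,v_2,v_3$ is an integer. Conventions for the explicit formula: exponentials act by their (locally finite) power series, so $S_2$ is an invertible operator on the polynomial ring. $f(z_2\partial_{z_2})$ and $f(x_1\partial_{x_1})$ act on a monomial by multiplication by $f$ of its exponent in $z_2$, respectively $x_1$. The factors involving $y_1/z_2$ take values in polynomials with negative powers of $z_2$ allowed; $1/\Gamma$ is taken to be $0$ at the nonpositive integers, so the factor $\Gamma(z_2\partial_{z_2}+u_2-v_3+1)/\Gamma(z_2\partial_{z_2}+1)$ annihilates monomials with negative powers of $z_2$. *)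

(* Defs.v *)
From HB Require Import structures.
From mathcomp Require Import all_boot all_order all_algebra.
(* In the other order, the notation levels of the next two imports clash. *)
From mathcomp Require Import freeg mpoly.
From mathcomp Require Import all_classical all_reals all_analysis.
From mathcomp Require Import complex.

Set Implicit Arguments.
Unset Strict Implicit.
Unset Printing Implicit Defensive.

Import Order.TTheory GRing.Theory Num.Theory.
Import numFieldNormedType.Exports.

Local Open Scope classical_set_scope.
Local Open Scope complex_scope.
Local Open Scope ring_scope.

(* Positions of x_1, y_1, z_1, x_2, y_2, z_2.  z_2 comes last, so that the
   monomials in the other five variables are 'X_{1..5}. *)
Definition x1 : 'I_6 := @Ordinal 6 0 isT.
Definition y1 : 'I_6 := @Ordinal 6 1 isT.
Definition z1 : 'I_6 := @Ordinal 6 2 isT.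
Definition x2 : 'I_6 := @Ordinal 6 3 isT.
Definition y2 : 'I_6 := @Ordinal 6 4 isT.
Definition z2 : 'I_6 := @Ordinal 6 5 isT.

Definition clim (K : numFieldType) (u : nat -> K) : K := lim (u @ \oo).

(* The power series of exp(T).  The sum is the finitely supported one: it is
   the intended value at p as soon as iter k T p = 0 for all large k. *)
Definition expop (K : fieldType) (V : lmodType K) (T : V -> V) (p : V) : V :=
  \sum_(k \in [set: nat]) (k`!%:R)^-1 *: iter k T p.

Section Gamma.
Variable R : realType.

(* n ^ z = exp (z ln n), for n > 0 *)
Definition npowc (n : nat) (z : R[i]) : R[i] :=
  let t := ln (n%:R : R) in
  let r := expR (complex.Re z * t) in
  (r * cos (complex.Im z * t)) +i* (r * sin (complex.Im z * t)).

(* Euler's limit n! n^z / (z (z + 1) ... (z + n)).  Division by 0 being 0, the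
   terms vanish eventually when z is a nonpositive integer; hence Gamma z = 0
   there, and so _ / Gamma z = 0: this is the convention 1/Gamma = 0 at the
   poles.  The value of Gamma itself at its poles is not meaningful. *)
Definition Gamma (z : R[i]) : R[i] :=
  clim (fun n => n`!%:R * npowc n z / \prod_(k < n.+1) (z + k%:R)).

End Gamma.

Section Lax.
Variable R : realType.
Local Notation C := R[i].
Local Notation P := {mpoly R[i][6]}.

Definition opmx_mul (A B : 'M[P -> P]_3) : 'M[P -> P]_3 :=
  \matrix_(i, j) (fun p => \sum_k A i k (B k j p)).

Definition op_opmx (T : P -> P) (A : 'M[P -> P]_3) : 'M[P -> P]_3 :=
  \matrix_(i, j) (T \o A i j).

Definition opmx_op (A : 'M[P -> P]_3) (T : P -> P) : 'M[P -> P]_3 :=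
  \matrix_(i, j) (A i j \o T).

Definition opmx_of_rows (rows : seq (seq (P -> P))) : 'M[P -> P]_3 :=
  \matrix_(i, j) nth (fun=> 0) (nth [::] rows i) j.

Definition Lax (x y z : 'I_6) (a1 a2 a3 : C) : 'M[P -> P]_3 :=
  let o : P -> P := fun=> 0 in
  let e : P -> P := id in
  let m (q : P) : P -> P := fun p => q * p in
  let s (a : C) : P -> P := fun p => a *: p in
  let d (i : 'I_6) : P -> P := fun p => p^`M(i) in
  opmx_mul
    (opmx_mul
      (opmx_of_rows [:: [:: e         ; o         ; o];
                        [:: m (- 'X_x); e         ; o];
                        [:: m (- 'X_y); m (- 'X_z); e]])
      (opmx_of_rows [:: [:: s a1; (fun p => d x p - 'X_z * d y p); d y];
                        [:: o   ; s a2                           ; d z];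
                        [:: o   ; o                              ; s a3]]))
    (opmx_of_rows [:: [:: e                     ; o      ; o];
                      [:: m 'X_x                ; e      ; o];
                      [:: m ('X_y + 'X_x * 'X_z); m 'X_z ; e]]).

Definition L1 := Lax x1 y1 z1.
Definition L2 := Lax x2 y2 z2.

Definition generic (u1 u2 u3 v1 v2 v3 : C) : Prop :=
  let w := [tuple u1; u2; u3; v1; v2; v3] in
  forall i j : 'I_6, i != j ->
  forall n : int, tnth w i - tnth w j != n%:~R.

(* The value at (u_1, u_2, v_2, v_3) is R_2(u_1, u_2 | v_2, v_3). *)
Definition opfamily := C -> C -> C -> C -> {linear P -> P}.

(* A 4-tuple is subject to the conditions below when it is part of a generic
   6-tuple; the values of a family at the other 4-tuples are irrelevant. *)
Definition translation_invariant (R2 : opfamily) : Prop :=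
  forall u1 u2 u3 v1 v2 v3 : C, generic u1 u2 u3 v1 v2 v3 ->
  forall (lam : C) (p : P),
    R2 u1 u2 v2 v3 p = R2 (u1 + lam) (u2 + lam) (v2 + lam) (v3 + lam) p.

Definition solves_defining_equations (R2 : opfamily) : Prop :=
  forall u1 u2 u3 v1 v2 v3 : C, generic u1 u2 u3 v1 v2 v3 ->
    op_opmx (R2 u1 u2 v2 v3) (opmx_mul (L1 u1 u2 u3) (L2 v1 v2 v3)) =
    opmx_op (opmx_mul (L1 u1 v2 u3) (L2 v1 u2 v3)) (R2 u1 u2 v2 v3).

End Lax.

Section ExplicitFormula.
Variable R : realType.
Local Notation C := R[i].
Local Notation P := {mpoly R[i][6]}.

Definition S2 : P -> P :=
  expop (fun p : P => ('X_y2 - 'X_x1 * 'X_z1) * p^`M(y1))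
  \o expop (fun p : P => 'X_z1 * p^`M(z2))
  \o expop (fun p : P => 'X_x2 * p^`M(x1)).

(* Inverse function of S2, with default value 0 outside of the range. *)
Definition S2inv : P -> P := 'pinv_(fun=> 0 : P) [set: P] S2.

(* C[x_1, y_1, z_1, x_2, y_2, z_2, z_2^-1], as the free vector space on the
   monomials: the first component holds the exponents of x_1, y_1, z_1, x_2,
   y_2, the second one the exponent of z_2. *)
Definition lmon : choiceType := ('X_{1..5} * int)%type.
Local Notation L := {freeg lmon / R[i]}.

Definition lx1 : 'I_5 := @Ordinal 5 0 isT.
Definition ly1 : 'I_5 := @Ordinal 5 1 isT.

Definition laurent_mon (m : 'X_{1..6}) : lmon :=
  ([multinom m (widen_ord (leqnSn 5) i) | i < 5], (m z2)%:Z).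

Definition laurent (p : P) : L :=
  \sum_(m <- msupp p) << p@_m *g laurent_mon m >>.

(* Left inverse of laurent that kills the negative powers of z_2. *)
Definition unlaurent : L -> P :=
  fglift (fun k : lmon =>
    if k.2 is Posz n then 'X_[mnmwiden k.1 + U_(z2) *+ n] else 0).

(* (y_1 / z_2) d/dx_1 *)
Definition y1z2_dx1 : L -> L :=
  fglift (fun k : lmon =>
    (k.1 lx1)%:R *: << ((k.1 - U_(lx1) + U_(ly1))%MM, k.2 - 1) : lmon >>).

(* f (x_1 d/dx_1) and f (z_2 d/dz_2) *)
Definition fun_x1dx1 (f : C -> C) : L -> L :=
  fglift (fun k : lmon => f (k.1 lx1)%:R *: << k >>).

Definition fun_z2dz2 (f : C -> C) : L -> L :=
  fglift (fun k : lmon => f (k.2)%:~R *: << k >>).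

Definition R2formula (u1 u2 v2 v3 : C) : P -> P :=
  S2inv
  \o unlaurent
  \o fun_z2dz2 (fun t => Gamma (t + u2 - v3 + 1) / Gamma (t + 1))
  \o expop y1z2_dx1
  \o fun_x1dx1 (fun t => Gamma (t + u1 - v2 + 1) / Gamma (t + u1 - u2 + 1))
  \o expop (fun q => - y1z2_dx1 q)
  \o fun_z2dz2 (fun t => Gamma (t + 1) / Gamma (t + v2 - v3 + 1))
  \o laurent
  \o S2.

End ExplicitFormula.

(* Main.v *)
Require Import Defs.
From HB Require Import structures.
From mathcomp Require Import all_boot all_order all_algebra.
From mathcomp Require Import freeg mpoly.
From mathcomp Require Import all_classical all_reals all_analysis.
From mathcomp Require Import complex.
From mathcomp Require Import ring lra.

(** Let sigma be the substitution operator [shear]: x1 -> x1 + x2,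
    y1 -> y1 + y2 - x1 z1, z2 -> z2 + z1, the other variables being fixed.  It
    is an algebra automorphism, and it is the operator S_2 of the formula
    ([S2E]).  Conjugating by sigma turns both Lax operators into
    ungauge o red_k o gauge with one and the same gauge ([shear_lax1],
    [shear_lax2]), so the inner gauge factors of the product L_1 L_2 cancel and
    the nine entries of the conjugated product become short ([red12E]).  They
    are assembled from multiplications by x2, y2, z1, y1, derivatives in
    x2, y2, z1, two Euler operators H1 = x1 d_x1 + y1 d_y1 and
    H2 = y1 d_y1 + z2 d_z2, an operator M, and
        X(q) = x1 (x1 d_x1 + q + 1) + y1 d_z2     at q = u1 - u2,
        Z(r) = z2 (z2 d_z2 + r + 1) + y1 d_x1     at r = v2 - v3.
    Apart from X and Z the parameters u2 and v2 enter symmetrically.  Hence an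
    operator T that commutes with everything else in the list and satisfies
        T X(u1 - u2) = X(u1 - v2) T,   T Z(v2 - v3) = Z(u2 - v3) T
    yields a solution sigma^-1 T sigma ([intw_lax]).  These requirements,
    without the one on M, are called [core_relations].

    Existence.  Commutation with H1 and H2 forces
    T (x1^a y1^b z2^c) = sum_k c_k(a, c) x1^(a-k) y1^(b+k) z2^(c-k), and the
    relations on X and Z become two-term recurrences, solved in closed form by
    quotients of rising factorials ([coef], [coef_opX], [coef_opZ]); the same
    closed form gives the commutation with M ([coef_opM]).  This T is [core].

    Uniqueness.  A family that is translation invariant and does not involve
    u3, v1 satisfies, with one and the same operator, the defining equations at
    (u1 + l, u2 + l, u3 + l + m | v1 + l + n, v2 + l, v3 + l); for integers
    l, m, n these parameters are again generic.  Both sides are polynomial in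
    l, m, n, and comparing their values for l, m, n in {0, 1} isolates the
    pieces of the matrices and shows that the conjugated operator T' satisfies
    the core relations ([core_relations_from_shifts]).  Then T' 1 is killed by
    d_x2, d_y2, d_z1, H1 and H2, so it is a constant, and since u1 - u2 and
    v2 - v3 are not integers, X, Z and the multiplications by x2, y2, z1, y1
    generate all monomials from 1.  So T' is a multiple of T
    ([core_relations_unique]).

    The formula.  Euler's limit is a convergent infinite product with nonzero
    value outside of the poles ([gamma_term_tends]), which gives
    Gamma (z + 1) = z Gamma z and turns the quotients of Gamma functions into
    rising factorials.  On a Laurent monomial the two exponentials then produce
    a double binomial sum; resumming it, the inner sum is a k-th finite
    difference of n -> (p+1)_n / (q+1)_n, which has a closed form
    ([difference_of_ratio]), and the result is T up to a nonzero product of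
    Gamma values ([formula_core_mon]). *)

Set Implicit Arguments.
Unset Strict Implicit.
Unset Printing Implicit Defensive.

Import Order.TTheory GRing.Theory Num.Theory.
Import numFieldNormedType.Exports.
Import ComplexField.Normc.

Local Open Scope classical_set_scope.
Local Open Scope complex_scope.
Local Open Scope ring_scope.

(** * The shear automorphism of the polynomial ring *)

Section Generators.
Variables (n : nat) (K : comNzRingType).

(** Linear operators that behave well under products are compared on the
    variables only; this is how identities between algebra morphisms and
    derivations are proved below. *)
Lemma mpoly_gen_ind (Q : {mpoly K[n]} -> Prop) :
  Q 1 -> (forall i, Q 'X_i) ->
  (forall p q, Q p -> Q q -> Q (p * q)) ->
  (forall p q, Q p -> Q q -> Q (p + q)) ->
  (forall c p, Q p -> Q (c *: p)) ->
  forall p, Q p.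
Proof.
move=> Q1 QX QM QD QZ p; rewrite (mpolyE p).
have Q0 : Q 0 by rewrite -(scale0r 1); apply: QZ.
apply: big_ind => // m _; apply: QZ; rewrite mpolyXE_id.
apply: big_ind => // i _; elim: (m i) => [|k IH]; first by rewrite expr0.
by rewrite exprS; apply: QM.
Qed.

Lemma mderivXU (i j : 'I_n) : ('X_i)^`M(j) = (i == j)%:R :> {mpoly K[n]}.
Proof.
rewrite mderivX mnm1E; case: eqVneq => [->|_]; last by rewrite scale0r.
by rewrite scale1r -{1}[U_(j)%MM]addm0 addmC addmK mpolyX0.
Qed.

Lemma mderiv1 (i : 'I_n) : mderiv i 1 = 0 :> {mpoly K[n]}.
Proof. by rewrite -mpolyC1 mderivC. Qed.

End Generators.

Section ChainRule.
Variables (n : nat) (K : comNzRingType).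

Lemma mderiv_comp (k : nat) (lq : n.-tuple {mpoly K[k]}) (i : 'I_k)
    (p : {mpoly K[n]}) :
  (p \mPo lq)^`M(i) = \sum_(j < n) (p^`M(j) \mPo lq) * (tnth lq j)^`M(i).
Proof.
elim/mpoly_gen_ind: p => [|j|p q IHp IHq|p q IHp IHq|c p IHp].
- rewrite comp_mpoly1 mderiv1 big1 // => j _.
  by rewrite mderiv1 comp_mpoly0 mul0r.
- rewrite comp_mpolyXU (bigD1 j) //= big1 => [|l lj].
    by rewrite mderivXU eqxx comp_mpoly1 mul1r addr0 (tnth_nth 0).
  by rewrite mderivXU eq_sym (negPf lj) comp_mpoly0 mul0r.
- rewrite rmorphM mderivM IHp IHq /= big_distrl big_distrr -big_split /=.
  apply: eq_bigr => j _; rewrite mderivM comp_mpolyD !rmorphM /=.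
  by rewrite mulrDl mulrAC mulrA.
- rewrite comp_mpolyD mderivD IHp IHq -big_split; apply: eq_bigr => j _ /=.
  by rewrite mderivD comp_mpolyD mulrDl.
- rewrite comp_mpolyZ mderivZ IHp scaler_sumr; apply: eq_bigr => j _.
  by rewrite mderivZ comp_mpolyZ scalerAl.
Qed.
End ChainRule.

(* The ring tactic compares atoms up to conversion; abstracting the polynomial
   variables, the constants and the derivatives first keeps this cheap. *)
Ltac mpoly_ring :=
  repeat match goal with |- context [@mderiv ?n ?R ?i ?p] =>
    generalize (@mderiv n R i p); intro end;
  repeat match goal with |- context [@mpolyX ?n ?R ?m] =>
    generalize (@mpolyX n R m); intro end;
  repeat match goal with |- context [@mpolyC ?n ?R ?c] =>
    generalize (@mpolyC n R c); intro end;
  ring.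

Section Shear.
Variable K : comNzRingType.
Local Notation P := {mpoly K[6]}.

(** The exponentials of x2 d_x1, z1 d_z2 and (y2 - x1 z1) d_y1, applied in this
    order, send the variables x1, y1, z1, x2, y2, z2 to these polynomials. *)
Definition shear_img : 6.-tuple P :=
  [tuple 'X_x1 + 'X_x2; 'X_y1 + 'X_y2 - 'X_x1 * 'X_z1; 'X_z1; 'X_x2; 'X_y2;
         'X_z2 + 'X_z1].

Definition unshear_img : 6.-tuple P :=
  [tuple 'X_x1 - 'X_x2; 'X_y1 + 'X_x1 * 'X_z1 - 'X_z1 * 'X_x2 - 'X_y2; 'X_z1;
         'X_x2; 'X_y2; 'X_z2 - 'X_z1].

Definition shear (p : P) : P := p \mPo shear_img.
Definition unshear (p : P) : P := p \mPo unshear_img.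

HB.instance Definition _ := GRing.LRMorphism.copy shear (comp_mpoly shear_img).
HB.instance Definition _ :=
  GRing.LRMorphism.copy unshear (comp_mpoly unshear_img).

Lemma ord6P (Q : 'I_6 -> Prop) :
  Q x1 -> Q y1 -> Q z1 -> Q x2 -> Q y2 -> Q z2 -> forall i, Q i.
Proof.
by move=> ? ? ? ? ? ? [[|[|[|[|[|[|//]]]]]] h];
   rewrite (bool_irrelevance h isT).
Qed.

Lemma big_ord6 (V : Type) (idx : V) (op : Monoid.law idx) (F : 'I_6 -> V) :
  \big[op/idx]_i F i =
  op (op (op (op (op (F x1) (F y1)) (F z1)) (F x2)) (F y2)) (F z2).
Proof.
rewrite 6!big_ord_recr big_ord0 /= Monoid.mul1m.
by do ![congr (op _ _)]; congr F; apply: val_inj.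
Qed.

Lemma shearX :
  (shear 'X_x1 = 'X_x1 + 'X_x2) *
  (shear 'X_y1 = 'X_y1 + 'X_y2 - 'X_x1 * 'X_z1) *
  (shear 'X_z1 = 'X_z1) * (shear 'X_x2 = 'X_x2) * (shear 'X_y2 = 'X_y2) *
  (shear 'X_z2 = 'X_z2 + 'X_z1).
Proof. by rewrite /shear !comp_mpolyXU. Qed.

Lemma unshearX :
  (unshear 'X_x1 = 'X_x1 - 'X_x2) *
  (unshear 'X_y1 = 'X_y1 + 'X_x1 * 'X_z1 - 'X_z1 * 'X_x2 - 'X_y2) *
  (unshear 'X_z1 = 'X_z1) * (unshear 'X_x2 = 'X_x2) *
  (unshear 'X_y2 = 'X_y2) * (unshear 'X_z2 = 'X_z2 - 'X_z1).
Proof. by rewrite /unshear !comp_mpolyXU. Qed.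

Lemma shearK : cancel shear unshear.
Proof.
elim/mpoly_gen_ind => [|i|p q Hp Hq|p q Hp Hq|c p Hp].
- by rewrite !rmorph1.
- elim/ord6P: i; rewrite !shearX ?(rmorphD, rmorphN, rmorphM) /= !unshearX;
  ring.
- by rewrite !rmorphM /= Hp Hq.
- by rewrite !rmorphD /= Hp Hq.
- by rewrite !linearZ /= Hp.
Qed.

Lemma unshearK : cancel unshear shear.
Proof.
elim/mpoly_gen_ind => [|i|p q Hp Hq|p q Hp Hq|c p Hp].
- by rewrite !rmorph1.
- elim/ord6P: i; rewrite !unshearX ?(rmorphD, rmorphN, rmorphM) /= !shearX;
  ring.
- by rewrite !rmorphM /= Hp Hq.
- by rewrite !rmorphD /= Hp Hq.
- by rewrite !linearZ /= Hp.
Qed.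

(** Chain rule; the quadratic term - x1 z1 in the image of y1 is responsible for
    the products with a variable. *)
Lemma shear_deriv (p : P) :
  (shear (p^`M(x1)) = (shear p)^`M(x1) + 'X_z1 * (shear p)^`M(y1)) *
  (shear (p^`M(y1)) = (shear p)^`M(y1)) *
  (shear (p^`M(z1)) =
    (shear p)^`M(z1) + 'X_x1 * (shear p)^`M(y1) - (shear p)^`M(z2)) *
  (shear (p^`M(x2)) =
    (shear p)^`M(x2) - (shear p)^`M(x1) - 'X_z1 * (shear p)^`M(y1)) *
  (shear (p^`M(y2)) = (shear p)^`M(y2) - (shear p)^`M(y1)) *
  (shear (p^`M(z2)) = (shear p)^`M(z2)).
Proof.
have D i := mderiv_comp shear_img i p.
rewrite /shear !D !big_ord6 !(tnth_nth 0) /=.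
rewrite !(mderivD, mderivN, mderivM, mderivXU) /=.
rewrite -!/(shear _).
do ![split]; mpoly_ring.
Qed.

End Shear.

(** * The Lax operators after conjugation *)

Section Weyl.
Variables (K : comNzRingType) (P : comAlgType K).

(** The matrix computations use of the polynomial ring only the commutation
    relations of multiplications and derivatives.  Keeping the algebra abstract
    keeps its elements opaque for the decision procedures. *)
Record partials (D : 'I_6 -> P -> P) (X : 'I_6 -> P) : Prop := Partials {
  partialD : forall i p q, D i (p + q) = D i p + D i q;
  partialZ : forall i a p, D i (a *: p) = a *: D i p;
  partialM : forall i p q, D i (p * q) = D i p * q + p * D i q;
  partialX : forall i j, D i (X j) = (j == i)%:R;
  partial_comm : forall i j p, D i (D j p) = D j (D i p)
}.

Variables (D : 'I_6 -> P -> P) (X : 'I_6 -> P).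
Hypothesis DX : partials D X.
Local Notation "p ^^ i" := (D i p) (at level 8).
Local Notation P3 := (P * P * P)%type.
Implicit Types (p f : P) (v : P3).

Definition map3 (f : P -> P) (v : P3) : P3 := (f v.1.1, f v.1.2, f v.2).

(** The Lax matrix as an operator on columns (v0, v1, v2): the columns w and t
    are the results of the right and of the middle factor. *)
Definition lax (x y z : 'I_6) (a1 a2 a3 : K) (v : P3) : P3 :=
  let: (v0, v1, v2) := v in
  let w1 := X x * v0 + v1 in
  let w2 := (X y + X x * X z) * v0 + X z * v1 + v2 in
  let t0 := a1 *: v0 + (w1^^x - X z * w1^^y) + w2^^y in
  let t1 := a2 *: w1 + w2^^z in
  (t0, t1 - X x * t0, a3 *: w2 - X z * t1 - X y * t0).

(** The common triangular factor: shear conjugates the right factor of either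
    Lax operator to a matrix that contains it, and the left factor to one that
    contains its inverse. *)
Definition gauge (v : P3) : P3 :=
  let: (v0, v1, v2) := v in
  (v0, X x2 * v0 + v1, (X y2 + X x2 * X z1) * v0 + X z1 * v1 + v2).

Definition ungauge (v : P3) : P3 :=
  let: (v0, v1, v2) := v in
  (v0, v1 - X x2 * v0, v2 - X z1 * v1 - X y2 * v0).

(** At q = u1 - u2, respectively r = v2 - v3, the operators [opX] and [opZ] are
    the parts of the product that the exchange of u2 and v2 alters. *)
Definition opX (q : K) (p : P) : P :=
  X x1 * (X x1 * p^^x1 + (q + 1) *: p) + X y1 * p^^z2.
Definition opZ0 (r : K) (p : P) : P :=
  X z2 * (X z2 * p^^z2 + (r + 1) *: p).
Definition opZ (r : K) (p : P) : P := X y1 * p^^x1 + opZ0 r p.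
Definition opH1 (p : P) : P := X x1 * p^^x1 + X y1 * p^^y1.
Definition opH2 (p : P) : P := X y1 * p^^y1 + X z2 * p^^z2.
Definition opd (p : P) : P := p^^x2 - X z1 * p^^y2.

(** Commutes with the solution although it involves the derivatives in x1 and
    z2, which individually do not; k is invariant under the exchange. *)
Definition opM (k : K) (p : P) : P :=
  p^^x1^^z2 - (opH1 p^^y1 + X z2 * p^^y1^^z2 + k *: p^^y1).

(** Reduced Lax operators: what is left of the conjugates of L_1 and L_2 once
    the gauge factors are split off. *)
Definition red1 (u1 u2 u3 : K) (v : P3) : P3 :=
  let: (v0, v1, v2) := v in
  ((u1 + 2) *: v0 + opH1 v0 + v1^^x1 + v2^^y1,
   X y1 * v0^^z1 - opX (u1 - u2) v0 + u2 *: v1 - X x1 * v1^^x1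
     + v2^^z1 - v2^^z2,
   - (X y1 * ((u1 - u3 + 2) *: v0 + opH1 v0)) - X y1 * v1^^x1
     + u3 *: v2 - X y1 * v2^^y1).

Definition red2 (a1 a2 a3 : K) (v : P3) : P3 :=
  let: (v0, v1, v2) := v in
  (a1 *: v0 + opd v1 - v1^^x1 + v2^^y2 - v2^^y1,
   (a2 + 1) *: v1 + X z2 * v1^^z2 + v2^^z2,
   - opZ0 (a2 - a3) v1 + a3 *: v2 - X z2 * v2^^z2).

Lemma ungaugeK : cancel ungauge gauge.
Proof. by case=> [[v0 v1] v2] /=; congr (_, _, _); ring. Qed.

Lemma partialN i p : (- p)^^i = - p^^i.
Proof. by rewrite -!scaleN1r (partialZ DX). Qed.

Lemma partial0 i : (0 : P)^^i = 0.
Proof. by have := partialZ DX i 0 0; rewrite !scale0r. Qed.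

Lemma partial1 i : (1 : P)^^i = 0.
Proof.
apply: (@addrI _ 1^^i).
by rewrite -[X in X + _ = _]mulr1 -[X in _ + X = _]mul1r -(partialM DX) mulr1
  addr0.
Qed.

Definition partialE := (partial0, partial1, partialD DX, partialN, partialZ DX,
  partialM DX, partialX DX).
Let dE := partialE.

(** Scalars as central elements: turns identities in an algebra into identities
    in a commutative ring. *)
Lemma constants : {c : K -> P & (forall a p, a *: p = c a * p) *
  (forall a b, c (a + b) = c a + c b) * (forall a b, c (a * b) = c a * c b) *
  (forall a, c (- a) = - c a) * (c 1 = 1) * (forall n, c n%:R = n%:R) *
    (c 0 = 0)}.
Proof.
exists (fun a => a%:A).
by do ![split]=> *;
  rewrite ?mulr_algl ?scalerDl ?scaleNr ?scale1r ?scale0r ?scalerA ?scaler_nat.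
Qed.

Lemma laxD x y z a1 a2 a3 v w :
  lax x y z a1 a2 a3 (v + w) = lax x y z a1 a2 a3 v + lax x y z a1 a2 a3 w.
Proof.
case: v w => [[f g] h] [[f' g'] h'] /=; rewrite !(mulrDr, partialD DX).
by have [c cE] := constants; rewrite !cE; congr (_, _, _) => /=; ring.
Qed.

Definition comMZ k r g : P := opM k (opZ r g) - opZ r (opM k g).
Definition comXM k q h : P := opX q (opM k h) - opM k (opX q h).

Let dC := partial_comm DX.

(** The point of the conjugation.  Apart from [opX] (u1 - u2) and
    [opZ] (a2 - a3), and the commutators with [opM] made from them, u2 and a2
    appear only through u2 + a2 and u2 * a2.  In the middle entry the terms of
    higher order combine into y1 times [opM] and a quadratic form in [opH1] and
    [opH2]. *)
Lemma red12E u1 u2 u3 a1 a2 a3 (f g h : P) :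
  let k := u1 - a3 + 2 in let q := u1 - u2 in let r := a2 - a3 in
  red1 u1 u2 u3 (red2 a1 a2 a3 (f, g, h)) =
  (a1 *: ((u1 + 2) *: f + opH1 f)
     + ((u1 + 2) *: opd g + opH1 (opd g) + comMZ k r g)
     + ((u1 + 2) *: h^^y2 + opH1 h^^y2 + opM k h),
   a1 *: (X y1 * f^^z1 - opX q f)
     + (X y1 * (opd g)^^z1 - (opZ r g)^^z1 - opX q (opd g)
        + (X y1 * opM k g + opH1 (opH1 g) + opH2 (opH2 g) - opH1 (opH2 g)
           + (u1 - u2 - a2 - 1) *: opH1 g + (u2 + a2 + 2 - a3) *: opH2 g
           + (u2 + a2 - a3 + 1 + u2 * a2) *: g))
     + (X y1 * h^^y2^^z1 - opX q h^^y2 + (a3 *: h - opH2 h)^^z1 + comXM k q h),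
   - (a1 *: (X y1 * ((u1 - u3 + 2) *: f + opH1 f)))
     - (X y1 * ((u1 - u3 + 2) *: opd g + opH1 (opd g)) + u3 *: opZ r g
        + X y1 * comMZ k r g)
     - (X y1 * ((u1 - u3 + 2) *: h^^y2 + opH1 h^^y2) + X y1 * opM k h
        - u3 *: (a3 *: h - opH2 h))).
Proof.
move=> /=.
have [c cE] := constants.
(* Mixed derivatives are brought into one order, as the algebra only knows
   that they commute. *)
have sortD := (dC y1 x1, dC z2 x1, dC z2 y1, dC x2 x1, dC x2 y1,
  dC x2 z2, dC y2 x1, dC y2 y1, dC y2 z2, dC z1 x1,
  dC z1 y1, dC z1 z2, dC z1 x2, dC z1 y2).
by congr (_, _, _); rewrite /comMZ /comXM /opM /opX /opZ /opZ0 /opH1 /opH2 /opd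
  ?dE /= ?sortD !cE; ring.
Qed.

End Weyl.

Section Intertwining.
Variables (K : comNzRingType) (P : comAlgType K).
Variables (D : 'I_6 -> P -> P) (X : 'I_6 -> P).
Hypothesis DX : partials D X.
Local Notation "p ^^ i" := (D i p) (at level 8).
Local Notation P3 := (P * P * P)%type.
Local Notation lax := (lax D X).
Local Notation gauge := (gauge X).
Local Notation ungauge := (ungauge X).
Local Notation opX := (opX D X).
Local Notation opZ := (opZ D X).
Local Notation opZ0 := (opZ0 D X).
Local Notation opH1 := (opH1 D X).
Local Notation opH2 := (opH2 D X).
Local Notation opM := (opM D X).
Local Notation opd := (opd D X).
Local Notation red1 := (red1 D X).
Local Notation red2 := (red2 D X).
Implicit Types (p f : P) (v : P3).

Let dE := partialE DX.

(** The conditions on the conjugated solution that can be read off from the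
    equations and that determine it up to a scalar. *)
Record core_relations (u1 u2 a2 a3 : K) (T : P -> P) : Prop := CoreRelations {
  intwD : forall p q, T (p + q) = T p + T q;
  intwZ : forall a p, T (a *: p) = a *: T p;
  intw_param : forall p, [/\ T (X x2 * p) = X x2 * T p,
    T (X y2 * p) = X y2 * T p, T (X z1 * p) = X z1 * T p
    & T (X y1 * p) = X y1 * T p];
  intw_deriv : forall p, [/\ T p^^x2 = (T p)^^x2, T p^^y2 = (T p)^^y2
    & T p^^z1 = (T p)^^z1];
  intw_opH1 : forall p, T (opH1 p) = opH1 (T p);
  intw_opH2 : forall p, T (opH2 p) = opH2 (T p);
  intw_opX : forall p, T (opX (u1 - u2) p) = opX (u1 - a2) (T p);
  intw_opZ : forall p, T (opZ (a2 - a3) p) = opZ (u2 - a3) (T p)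
}.

Section Intertwiner.
Variables (u1 u2 a2 a3 : K) (T : P -> P).
Hypothesis HT : core_relations u1 u2 a2 a3 T.
Hypothesis intw_opM : forall p, T (opM (u1 - a3 + 2) p) =
  opM (u1 - a3 + 2) (T p).

Let TD := intwD HT.
Let TZ := intwZ HT.

Lemma intwN p : T (- p) = - T p.
Proof. by rewrite -!scaleN1r TZ. Qed.

Let TC p : (T (X x2 * p) = X x2 * T p) * (T (X y2 * p) = X y2 * T p) *
  (T (X z1 * p) = X z1 * T p) * (T (X y1 * p) = X y1 * T p) *
  (T p^^x2 = (T p)^^x2) * (T p^^y2 = (T p)^^y2) * (T p^^z1 = (T p)^^z1).
Proof. by have [? ? ? ?] := intw_param HT p; have [] := intw_deriv HT p. Qed.

Let Td p : T (opd p) = opd (T p).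
Proof. by rewrite /opd TD intwN !TC. Qed.

Lemma intw_red12 u3 a1 v :
  map3 T (red1 u1 u2 u3 (red2 a1 a2 a3 v)) =
  red1 u1 a2 u3 (red2 a1 u2 a3 (map3 T v)).
Proof.
case: v => [[f g] h]; rewrite !(red12E DX) /map3 /=.
rewrite /comMZ /comXM !(intw_opH1 HT, intw_opH2 HT, intw_opM, intw_opX HT,
  intw_opZ HT,
  Td, TC, TZ, intwN, TD).
have aC : (a2 + u2 = u2 + a2) * (a2 * u2 = u2 * a2) by rewrite addrC mulrC.
by rewrite !aC (addrAC u1 (- a2)).
Qed.

Lemma intw_gauge v : map3 T (gauge v) = gauge (map3 T v).
Proof.
by case: v => [[f g] h]; rewrite /map3 /= !mulrDl -!mulrA !(TD, TC).
Qed.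

Lemma intw_ungauge v : map3 T (ungauge v) = ungauge (map3 T v).
Proof. by case: v => [[f g] h]; rewrite /map3 /= !(TD, intwN, TC). Qed.
End Intertwiner.

(** The converse direction.  The parameters l, m, n stand for a common shift of
    all six parameters, a shift of u3 and a shift of v1; T is the same for all
    of them. *)
Section FromShifts.
Variables (u1 u2 u3 a1 a2 a3 : K) (T : P -> P).
Hypothesis TD : forall p q, T (p + q) = T p + T q.
Hypothesis TZ : forall a p, T (a *: p) = a *: T p.

Let red12 u1 u2 a2 a3 l m n v :=
  red1 (u1 + l) (u2 + l) (u3 + l + m) (red2 (a1 + l + n) (a2 + l) (a3 + l) v).
Hypothesis HT : forall l m n : bool, forall v,
  map3 T (ungauge (red12 u1 u2 a2 a3 l%:R m%:R n%:R (gauge v))) =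
  ungauge (red12 u1 a2 u2 a3 l%:R m%:R n%:R (gauge (map3 T v))).

(** Coefficients of m and n in the reduced operators. *)
Let k1 (v : P3) : P3 := (0, 0, X y1 * v.1.1 + v.2).
Let k2 (v : P3) : P3 := (v.1.1, 0, 0).

Let red1D b1 b2 b3 v w : red1 b1 b2 b3 (v + w) =
  red1 b1 b2 b3 v + red1 b1 b2 b3 w.
Proof.
case: v w => [[f g] h] [[f' g'] h'] /=; rewrite /opX /opH1 ?dE.
have [c cE] := constants P; rewrite !cE.
by congr (_, _, _) => /=; ring.
Qed.

Let red1Z b1 b2 b3 l v : red1 b1 b2 b3 (l *: v) = l *: red1 b1 b2 b3 v.
Proof.
case: v => [[f g] h] /=; rewrite /opX /opH1 ?dE.
have [c cE] := constants P.
by congr (_, _, _) => /=; rewrite !cE; ring.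
Qed.

Let red1_shift b1 b2 b3 l m v :
  red1 (b1 + l) (b2 + l) (b3 + l + m) v =
  red1 b1 b2 b3 v + l *: v + m *: k1 v.
Proof.
case: v => [[f g] h] /=; rewrite /opX /opH1 ?dE.
have [c cE] := constants P.
by congr (_, _, _) => /=; rewrite !cE; ring.
Qed.

Let red2_shift b1 b2 b3 l n v :
  red2 (b1 + l + n) (b2 + l) (b3 + l) v =
  red2 b1 b2 b3 v + l *: v + n *: k2 v.
Proof.
case: v => [[f g] h] /=; rewrite /opZ0 /opd ?dE.
have [c cE] := constants P.
by congr (_, _, _) => /=; rewrite !cE; ring.
Qed.

(** Polynomial dependence on l, m, n.  The coefficients of l m and l n are
    [k1] and [k2] alone, so T commutes with their gauge conjugates; this yields
    the multiplications by x2, y2, z1, y1, and then the gauge can be removed. *)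
Let red12_shift b1 b2 b3 b4 l m n v (A := red1 b1 b2 u3) (B := red2 a1 b3 b4) :
  red12 b1 b2 b3 b4 l m n v =
  A (B v) + l *: (A v + B v + l *: v) + m *: (k1 (B v) + n *: k1 (k2 v))
  + n *: A (k2 v) + (l * m) *: k1 v + (l * n) *: k2 v.
Proof.
rewrite /red12 red1_shift red2_shift !red1D !red1Z -/A -/B.
have -> w w' : k1 (w + w') = k1 w + k1 w'.
  by congr (_, _, _); rewrite /= ?addr0 // mulrDr addrACA.
have -> w w' : k1 (w + w') = k1 w + k1 w'.
  by congr (_, _, _); rewrite /= ?addr0 // mulrDr addrACA.
have k1Z a w : k1 (a *: w) = a *: k1 w.
  by congr (_, _, _); rewrite /= ?scaler0 // scalerDr scalerAr.
have [c cE] := constants P.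
rewrite !k1Z; move: (A (B v)) (A v) (A (k2 v)) (k1 (B v)) (k1 (k2 v)) (B v)
  (k1 v) (k2 v) => w1 w2 w3 w4 w5 w6 w7 w8.
by congr (_, _, _) => /=; rewrite !cE; ring.
Qed.

Let ungaugeD v w : ungauge (v + w) = ungauge v + ungauge w.
Proof. by case: v w => [[f g] h] [[f' g'] h'] /=; congr (_, _,
  _) => /=; ring. Qed.

Let T3D v w : map3 T (v + w) = map3 T v + map3 T w.
Proof. by rewrite /map3 /= !TD. Qed.

Let T0 : T 0 = 0.
Proof. by rewrite -(scale0r 0) TZ !scale0r. Qed.

Let TN p : T (- p) = - T p.
Proof. by rewrite -!scaleN1r TZ. Qed.

Let HT0 v := HT false false false v.
Let HTl v := HT true false false v.
Let HTm v := HT false true false v.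
Let HTn v := HT false false true v.
Let HTlm v := HT true true false v.
Let HTln v := HT true false true v.

Let simp := (mul1r, mulr0, mul0r, scale1r, scale0r, addr0).

Let T_k2 v : map3 T (ungauge (k2 (gauge v))) = ungauge (k2 (gauge (map3 T v))).
Proof.
move: (HTln v) (HTl v) (HTn v) (HT0 v); rewrite !red12_shift !simp.
rewrite !(ungaugeD, T3D) => + e1 e2 e0.
by rewrite e0 in e1 e2 *; rewrite (addrI _ e1) (addrI _ e2) => /addrI.
Qed.

Let T_k1 v : map3 T (ungauge (k1 (gauge v))) = ungauge (k1 (gauge (map3 T v))).
Proof.
move: (HTlm v) (HTl v) (HTm v) (HT0 v); rewrite !red12_shift !simp.
rewrite !(ungaugeD, T3D) => + e1 e2 e0.
by rewrite e0 in e1 e2 *; rewrite (addrI _ e1) (addrI _ e2) => /addrI.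
Qed.

Let simp0 := (T0, mulr0, subr0, add0r, addr0, oppr0).

Let Tx2 p : T (X x2 * p) = X x2 * T p.
Proof.
move/(congr1 (fun w => w.1.2)): (T_k2 (p, 0, 0)).
by rewrite /map3 /= !simp0 TN => /oppr_inj.
Qed.

Let Ty2 p : T (X y2 * p) = X y2 * T p.
Proof.
move/(congr1 (fun w => w.2)): (T_k2 (p, 0, 0)).
by rewrite /map3 /= !simp0 TN => /oppr_inj.
Qed.

Let Tz1 p : T (X z1 * p) = X z1 * T p.
Proof.
move/(congr1 (fun w => w.2)): (T_k1 (0, p, 0)).
by rewrite /map3 /= !simp0.
Qed.

Let Ty1 p : T (X y1 * p) = X y1 * T p.
Proof.
move/(congr1 (fun w => w.2)): (T_k1 (p, 0, 0)).
rewrite /map3 /= !simp0 TD mulrDl TD Ty2 -mulrA Tx2 Tz1 mulrA -mulrDl.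
by move/addIr.
Qed.

Let T_gauge v : map3 T (gauge v) = gauge (map3 T v).
Proof.
by case: v => [[f g] h]; rewrite /map3 /= !mulrDl -!mulrA !(TD, Tx2, Ty2, Tz1).
Qed.

Let T_ungauge v : map3 T (ungauge v) = ungauge (map3 T v).
Proof. by case: v => [[f g] h]; rewrite /map3 /= !(TD, TN, Tx2, Ty2, Tz1). Qed.

Let T_red (l m n : bool) v : map3 T (red12 u1 u2 a2 a3 l%:R m%:R n%:R v) =
  red12 u1 a2 u2 a3 l%:R m%:R n%:R (map3 T v).
Proof.
have := HT l m n (ungauge v);
  rewrite ungaugeK T_ungauge => /(can_inj (ungaugeK _)).
by rewrite -T_gauge ungaugeK.
Qed.

(** With the gauge removed, the coefficients of l, m and n give three matrix
    identities of first order, whose entries are the core relations. *)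
Let T_sum v : map3 T (red1 u1 u2 u3 v + red2 a1 a2 a3 v) =
  red1 u1 a2 u3 (map3 T v) + red2 a1 u2 a3 (map3 T v).
Proof.
move: (T_red true false false v) (T_red false false false v).
rewrite !red12_shift !simp !T3D => + e0.
by rewrite e0 => /addrI/addIr.
Qed.

Let T_k1red v : map3 T (k1 (red2 a1 a2 a3 v)) = k1 (red2 a1 u2 a3 (map3 T v)).
Proof.
move: (T_red false true false v) (T_red false false false v).
by rewrite !red12_shift !simp !T3D => + e0; rewrite e0 => /addrI.
Qed.

Let T_redk2 v : map3 T (red1 u1 u2 u3 (k2 v)) = red1 u1 a2 u3 (k2 (map3 T v)).
Proof.
move: (T_red false false true v) (T_red false false false v).
by rewrite !red12_shift !simp !T3D => + e0; rewrite e0 => /addrI.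
Qed.

Let simpd := (simp0, scaler0, partial0 DX).

Let Td p : T (opd p) = opd (T p).
Proof.
move/(congr1 (fun w => w.1.1)): (T_sum (0, p, 0)).
have E (a b : P) : a + (b - a) = b by rewrite addrC subrK.
by rewrite /map3 /= /opH1 /opd !simpd !E.
Qed.

Let Tdy2 p : T p^^y2 = (T p)^^y2.
Proof.
move/(congr1 (fun w => w.1.1)): (T_sum (0, 0, p)).
have E (a b : P) : a + (b - a) = b by rewrite addrC subrK.
by rewrite /map3 /= /opH1 /opd !simpd !E.
Qed.

Let Tdx2 p : T p^^x2 = (T p)^^x2.
Proof.
by apply: (@addIr _ (- (X z1 * (T p)^^y2)));
  rewrite -/(opd _) -Td TD TN Tz1 Tdy2.
Qed.

Let Tdz1 p : T p^^z1 = (T p)^^z1.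
Proof.
move/(congr1 (fun w => w.1.2)): (T_sum (0, 0, p)).
by rewrite /map3 /= /opX !simpd !subrK.
Qed.

Let TH1 p : T (opH1 p) = opH1 (T p).
Proof.
move/(congr1 (fun w => w.1.1)): (T_sum (p, 0, 0)).
by rewrite /map3 /= /opd !simpd !(TD, TZ) => /addIr/addrI; rewrite -TD.
Qed.

Let TZ' p : T (opZ (a2 - a3) p) = opZ (u2 - a3) (T p).
Proof.
move/(congr1 (fun w => w.2)): (T_k1red (0, p, 0)).
rewrite /map3 /= !simpd TD TN Ty1 TD TN Td !(mulrBr (X y1) (opd _)) -!addrA.
by move/addrI; rewrite -!opprD => /oppr_inj; rewrite /opZ TD Ty1.
Qed.

Let TH2 p : T (opH2 p) = opH2 (T p).
Proof.
move/(congr1 (fun w => w.2)): (T_k1red (0, 0, p)).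
rewrite /map3 /= /opd /opZ0 !simpd !(TD, TN, TZ, Ty1) Tdy2 !mulrBr.
by rewrite !(addrACA _ (- _)) -!opprD => /addrI/oppr_inj.
Qed.

Let TX p : T (opX (u1 - u2) p) = opX (u1 - a2) (T p).
Proof.
move/(congr1 (fun w => w.1.2)): (T_redk2 (p, 0, 0)).
by rewrite /map3 /= !simpd TD TN Ty1 Tdz1 => /addrI/oppr_inj.
Qed.

Lemma core_relations_from_shifts : core_relations u1 u2 a2 a3 T.
Proof. by split=> // p; split. Qed.

End FromShifts.

Section Conjugation.
Variable s : P -> P.
Hypothesis sE : (forall p q, s (p + q) = s p + s q) *
  (forall p q, s (p * q) = s p * s q) * (forall p, s (- p) = - s p) *
  (forall a p, s (a *: p) = a *: s p) * (s 0 = 0) * (s 1 = 1).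
Hypothesis sX :
  (s (X x1) = X x1 + X x2) * (s (X y1) = X y1 + X y2 - X x1 * X z1) *
  (s (X z1) = X z1) * (s (X x2) = X x2) * (s (X y2) = X y2) *
  (s (X z2) = X z2 + X z1).
Hypothesis sD : forall p,
  (s p^^x1 = (s p)^^x1 + X z1 * (s p)^^y1) * (s p^^y1 = (s p)^^y1) *
  (s p^^z1 = (s p)^^z1 + X x1 * (s p)^^y1 - (s p)^^z2) *
  (s p^^x2 = (s p)^^x2 - (s p)^^x1 - X z1 * (s p)^^y1) *
  (s p^^y2 = (s p)^^y2 - (s p)^^y1) * (s p^^z2 = (s p)^^z2).

(** Both sides are computed: the change of variables for the derivatives ([sD])
    absorbs the variables of the other tensor factor into the gauge. *)
Lemma shear_lax1 u1 u2 u3 v :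
  map3 s (lax x1 y1 z1 u1 u2 u3 v) =
  ungauge (red1 u1 u2 u3 (gauge (map3 s v))).
Proof.
case: v => [[v0 v1] v2]; rewrite /map3 /= /opX /opH1 /=.
rewrite !dE /= !sE !sD !sX.
move: (s v0) (s v1) (s v2) => f g h; rewrite ?dE /=.
by have [c cE] := constants P; rewrite !cE; congr (_, _, _); ring.
Qed.

Lemma shear_lax2 u1 u2 u3 v :
  map3 s (lax x2 y2 z2 u1 u2 u3 v) =
  ungauge (red2 u1 u2 u3 (gauge (map3 s v))).
Proof.
case: v => [[v0 v1] v2]; rewrite /map3 /= /opZ0 /opd /=.
rewrite !dE /= !sE !sD !sX.
move: (s v0) (s v1) (s v2) => f g h; rewrite ?dE /=.
by have [c cE] := constants P; rewrite !cE; congr (_, _, _); ring.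
Qed.

Variables (s' : P -> P) (u1 u2 a2 a3 : K) (T : P -> P).
Hypotheses (sK : cancel s s') (s'K : cancel s' s).
Hypothesis HT : core_relations u1 u2 a2 a3 T.
Hypothesis intw_opM : forall p, T (opM (u1 - a3 + 2) p) =
  opM (u1 - a3 + 2) (T p).

Lemma shear_lax12 u3 a1 b1 b2 b3 b4 v :
  map3 s (lax x1 y1 z1 b1 b2 u3 (lax x2 y2 z2 a1 b3 b4 v)) =
  ungauge (red1 b1 b2 u3 (red2 a1 b3 b4 (gauge (map3 s v)))).
Proof. by rewrite shear_lax1 shear_lax2 ungaugeK. Qed.

Lemma lax12_conj (F : P -> P) b1 b2 b3 b4 b5 b6 c1 c2 c3 c4 c5 c6 :
  (forall v, map3 F (lax x1 y1 z1 b1 b2 b3 (lax x2 y2 z2 b4 b5 b6 v)) =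
    lax x1 y1 z1 c1 c2 c3 (lax x2 y2 z2 c4 c5 c6 (map3 F v))) ->
  let F' := s \o F \o s' in
  forall v, map3 F' (ungauge (red1 b1 b2 b3 (red2 b4 b5 b6 (gauge v)))) =
    ungauge (red1 c1 c2 c3 (red2 c4 c5 c6 (gauge (map3 F' v)))).
Proof.
move=> HF F' v; have sK3 w : map3 s (map3 s' w) = w.
  by case: w => [[f g] h]; rewrite /map3 /= !s'K.
have s'K3 w : map3 s' (map3 s w) = w.
  by case: w => [[f g] h]; rewrite /map3 /= !sK.
rewrite -{1}(sK3 v) -shear_lax12.
have -> w : map3 F' w = map3 s (map3 F (map3 s' w)) by [].
rewrite s'K3 HF shear_lax12.
by [].
Qed.

Lemma intw_lax u3 a1 v :
  map3 (s' \o T \o s) (lax x1 y1 z1 u1 u2 u3 (lax x2 y2 z2 a1 a2 a3 v)) =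
  lax x1 y1 z1 u1 a2 u3 (lax x2 y2 z2 a1 u2 a3 (map3 (s' \o T \o s) v)).
Proof.
have inj : injective (map3 s).
  by move=> [[f g] h] [[f' g'] h'] [/(can_inj sK)-> /(can_inj sK)-> /(can_inj
    sK)->].
apply: inj.
have -> w : map3 s (map3 (s' \o T \o s) w) = map3 T (map3 s w).
  by rewrite /map3 /= !s'K.
rewrite !shear_lax12 (intw_ungauge HT) (intw_red12 HT intw_opM) (intw_gauge HT).
by rewrite /map3 /= !s'K.
Qed.
End Conjugation.
End Intertwining.

(** * The coefficients of the core operator *)

Section Coefficients.
Variable K : numFieldType.
Implicit Types (al : K) (n k a c : nat).

(** (al)_n / n!; with the factorials included, the coefficients below are
    products of such quotients and their inverses. *)
Definition rising_ratio al n : K := \prod_(j < n) ((al + j%:R) / j.+1%:R).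
Local Notation rho := rising_ratio.

Lemma rising_ratio0 al : rho al 0 = 1.
Proof. by rewrite /rho big_ord0. Qed.

Lemma rising_ratioS al n : rho al n.+1 = rho al n * ((al + n%:R) / n.+1%:R).
Proof. by rewrite /rho big_ord_recr. Qed.

(** The form in which genericity enters: rising factorials of such numbers do
    not vanish. *)
Definition nonint al := forall n : int, al != n%:~R.

Lemma nonint_neq0 al n : nonint al -> al + n%:R != 0.
Proof. by move=> h; rewrite addr_eq0; have := h (- n%:Z); rewrite mulrNz. Qed.

Lemma nonintD1 al : nonint al -> nonint (al + 1).
Proof. by move=> h n; have := h (n - 1); rewrite intrD -subr_eq opprK. Qed.

Lemma rising_ratio_neq0 al n : nonint al -> rho al n != 0.
Proof.
move=> h; rewrite /rho; apply/prodf_neq0 => j _.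
by rewrite mulf_neq0 ?nonint_neq0 // invr_eq0 pnatr_eq0.
Qed.

Variables p q r s : K.
(** The coefficient of x1^(a-k) y1^k z2^(c-k) in the image of x1^a z2^c,
    normalized so that 1 is mapped to 1. *)
Definition coef a c k : K :=
  if (k <= a)%N && (k <= c)%N then
    (rho (q + 1) a)^-1 * (rho (r + 1) c)^-1 * ((-1) ^+ k * rho (q - p) k)
    * rho (p + 1) (a - k) * rho (s + 1) (c - k)
  else 0.

Hypotheses (hq : nonint q) (hr : nonint r).
Hypothesis Hpqrs : s = r + (p - q).

Lemma coef_gtl a c k : (a < k)%N -> coef a c k = 0.
Proof. by rewrite ltnNge /coef => /negPf->. Qed.

Lemma coef_gtr a c k : (c < k)%N -> coef a c k = 0.
Proof. by rewrite ltnNge /coef andbC => /negPf->. Qed.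

Lemma coef_add k i j : coef (k + i) (k + j) k =
  (rho (q + 1) (k + i))^-1 * (rho (r + 1) (k + j))^-1
  * ((-1) ^+ k * rho (q - p) k) * rho (p + 1) i * rho (s + 1) j.
Proof. by rewrite /coef !leq_addr !addKn. Qed.

(** The intertwining relation of [opX], read off at x1^(a-k) y1^(k+1)
    z2^(c-k-1).  After the boundary cases a < k and c <= k the substitution
    a = k + i, c = k + j + 1 makes it an identity of rational functions. *)
Lemma coef_opX a c k :
  (a%:R + q + 1) * coef a.+1 c k.+1 - (a%:R - k%:R + p) * coef a c k.+1
  = (c%:R - k%:R) * coef a c k - c%:R * coef a c.-1 k.
Proof.
have [ltak|leka] := ltnP a k.
  by rewrite (@coef_gtl a.+1) // !(@coef_gtl a) // ?ltnS ?(ltnW ltak) // !mulr0.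
have [lekc|leck] := ltnP k c; last first.
  rewrite !(@coef_gtr _ c k.+1) // !mulr0 subrr.
  move: leck; rewrite leq_eqVlt => /predU1P[->|ltck].
    case: k leka => [|k] _; first by rewrite subrr !mul0r subrr.
    by rewrite subrr mul0r (@coef_gtr _ k) // mulr0 subrr.
  rewrite !coef_gtr ?mulr0 ?subrr //.
  by rewrite (leq_ltn_trans _ ltck) // leq_pred.
have [i ai] : exists i, a = (k + i)%N by exists (a - k)%N; rewrite subnKC.
have [j cj] : exists j, c = (k + j).+1 by exists (c - k.+1)%N;
  rewrite -addSn subnKC.
rewrite {}ai {}cj {leka lekc} /= -addSn coef_add.
have -> : (k + i)%:R - k%:R + p = i%:R + p by rewrite natrD; ring.
have -> : (i%:R + p) * coef (k + i) (k.+1 + j) k.+1 =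
   i%:R * ((rho (q + 1) (k + i))^-1 * (rho (r + 1) (k.+1 + j))^-1
  * ((-1) ^+ k.+1 * rho (q - p) k.+1) * rho (p + 1) i * rho (s + 1) j).
  case: i => [|i]; first by rewrite coef_gtl ?mulr0 ?mul0r ?addn0.
  rewrite addnS -addSn coef_add [rho _ i.+1]rising_ratioS.
  move: (rho _ _)^-1 (rho _ _)^-1 (rho _ i) (rho _ j) (rho _ k.+1) => A B F G d.
  rewrite exprS -natr1; field; by rewrite natr1.
rewrite -[in coef (k + i).+1 _ _](addSn k i) coef_add.
rewrite [in coef (k + i) (k.+1 + j) k]addSnnS !coef_add -addSnnS.
rewrite (addSn k j) exprS !rising_ratioS.
rewrite Hpqrs -!natr1 !natrD.
field.
rewrite -!natrD !natr1 !pnatr_eq0 !nonint_neq0 ?rising_ratio_neq0 //=;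
  exact: nonintD1.
Qed.

(** The commutation with [opM], read off in the same way.  The linear factor on
    the right collects the contributions of the Euler operators. *)
Lemma coef_opM a c k :
  a%:R * c%:R * coef a.-1 c.-1 k - (a%:R - k%:R) * (c%:R - k%:R) * coef a c k
  = - (k.+1%:R * (a%:R + c%:R - k%:R + (p + r)) * coef a c k.+1).
Proof.
have [ltka|leak] := ltnP k a; last first.
  rewrite (@coef_gtl a c k.+1) // mulr0 oppr0.
  move: leak; rewrite leq_eqVlt => /predU1P[->|ltak].
    case: k => [|k]; first by rewrite subrr !mul0r subrr.
    by rewrite subrr !mul0r (@coef_gtl _ _ k.+1) // mulr0 subrr.
  by rewrite !coef_gtl ?mulr0 ?subrr // (leq_ltn_trans _ ltak) // leq_pred.
have [ltkc|leck] := ltnP k c; last first.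
  rewrite (@coef_gtr a c k.+1) // mulr0 oppr0.
  move: leck; rewrite leq_eqVlt => /predU1P[->|ltck].
    case: k ltka => [|k] _; first by rewrite subrr !mulr0 !mul0r subrr.
    by rewrite subrr !mulr0 mul0r (@coef_gtr _ _ k.+1) // mulr0 subrr.
  by rewrite !coef_gtr ?mulr0 ?subrr // (leq_ltn_trans _ ltck) // leq_pred.
have [i ai] : exists i, a = (k + i).+1 by exists (a - k.+1)%N;
  rewrite -addSn subnKC.
have [j cj] : exists j, c = (k + j).+1 by exists (c - k.+1)%N;
  rewrite -addSn subnKC.
rewrite {}ai {}cj {ltka ltkc} -!pred_Sn coef_add.
rewrite -[in coef _ _ k.+1](addSn k i) -[in coef _ _ k.+1](addSn k j) coef_add.
rewrite -[in coef _ _ k](addnS k i) -[in coef _ _ k](addnS k j) coef_add.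
rewrite (addSn k i) (addSn k j) (addnS k i) (addnS k j) exprS !rising_ratioS.
rewrite Hpqrs -!natr1 !natrD; field.
rewrite -!natrD !natr1 !pnatr_eq0 !nonint_neq0 ?rising_ratio_neq0 //=;
  exact: nonintD1.
Qed.

End Coefficients.

(** The exchange of the roles of x1 and z2; it reduces the relation of [opZ] to
    the one of [opX]. *)
Lemma coefC (K : numFieldType) (p q r s : K) a c k :
  s = r + (p - q) -> coef p q r s a c k = coef s r q p c a k.
Proof.
move=> e; rewrite /coef andbC; case: ifP => // _.
have -> : r - s = q - p by rewrite e; ring.
by ring.
Qed.

Lemma coef_opZ (K : numFieldType) (p q r s : K) a c k :
  nonint q -> nonint r -> s = r + (p - q) ->
  (c%:R + r + 1) * coef p q r s a c.+1 k.+1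
    - (c%:R - k%:R + s) * coef p q r s a c k.+1
  = (a%:R - k%:R) * coef p q r s a c k - a%:R * coef p q r s a.-1 c k.
Proof.
move=> hq hr e; rewrite !(coefC _ _ _ e); apply: coef_opX => //.
by rewrite e; ring.
Qed.

Lemma coef_0 (K : numFieldType) (p q r s : K) a c :
  coef p q r s a c 0 = (rising_ratio (q + 1) a)^-1 * (rising_ratio (r + 1) c)^-1
    * rising_ratio (p + 1) a * rising_ratio (s + 1) c.
Proof. by rewrite /coef /= !subn0 expr0 rising_ratio0 !mulr1. Qed.

(** The relation of [opX] at k = 0, where the term with index k - 1 is absent;
    likewise for [opZ] in the next lemma. *)
Lemma coef_opX0 (K : numFieldType) (p q r s : K) a c :
  nonint q -> nonint r ->
  (a%:R + q + 1) * coef p q r s a.+1 c 0 = (a%:R + p + 1) * coef p q r s a c 0.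
Proof.
move=> hq hr; rewrite !coef_0 !rising_ratioS -!natr1; field.
rewrite !natr1 !pnatr_eq0 !nonint_neq0 ?rising_ratio_neq0 //=;
  exact: nonintD1.
Qed.

Lemma coef_opZ0 (K : numFieldType) (p q r s : K) a c :
  nonint q -> nonint r ->
  (c%:R + r + 1) * coef p q r s a c.+1 0 = (c%:R + s + 1) * coef p q r s a c 0.
Proof.
move=> hq hr; rewrite !coef_0 !rising_ratioS -!natr1; field.
rewrite !natr1 !pnatr_eq0 !nonint_neq0 ?rising_ratio_neq0 //=;
  exact: nonintD1.
Qed.

(** * Monomials and linear extensions *)

Section LinearExtension.
Variables (K : comNzRingType) (T : choiceType) (V : lmodType K) (f : T -> V).

Lemma fglift_is_linear : linear (fglift f).
Proof.
have fgB := @lift_is_additive K T V f.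
have fg0 : fglift f 0 = 0 by rewrite -[in LHS](subrr 0) fgB subrr.
have fgN d : fglift f (- d) = - fglift f d by rewrite -[- d]sub0r fgB fg0 sub0r.
have fgD (c d : {freeg T / K}) : fglift f (c + d) = fglift f c + fglift f d.
  by rewrite -[d in LHS]opprK fgB fgN opprK.
move=> a c d; rewrite fgD; congr (_ + _).
have fg_sum (r : seq T) (F : T -> {freeg T / K}) :
    fglift f (\sum_(x <- r) F x) = \sum_(x <- r) fglift f (F x).
  by elim: r => [|x r IH]; rewrite ?big_nil // !big_cons fgD IH.
rewrite -[in RHS](freeg_sumE c) fg_sum.
rewrite [a *: c]/GRing.scale /= /fgscale fg_sum scaler_sumr.
by apply: eq_bigr => x _; rewrite !liftU scalerA.
Qed.
End LinearExtension.

Section MonomialExtension.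
Variables (n : nat) (K : comNzRingType) (V : lmodType K) (f : 'X_{1..n} -> V).

Definition monlift (p : {mpoly K[n]}) : V := fglift f (mpoly_val p).

Lemma monlift_is_linear : linear monlift.
Proof. by move=> a p q; rewrite /monlift -fglift_is_linear. Qed.

HB.instance Definition _ := GRing.isLinear.Build K {mpoly K[n]} V _ monlift
  monlift_is_linear.

Lemma monliftX m : monlift 'X_[m] = f m.
Proof. by rewrite /monlift unlock /= liftU scale1r. Qed.

Lemma monliftE p : monlift p = \sum_(m <- msupp p) p@_m *: f m.
Proof.
rewrite {1}(mpolyE p) raddf_sum; apply: eq_bigr => m _.
by rewrite /= linearZ /= monliftX.
Qed.
End MonomialExtension.

Section Monomials.
Variable K : numFieldType.
Local Notation P := {mpoly K[6]}.
Implicit Types (a b c i j l : nat).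

(** The three variables on which the core operator acts come first. *)
Definition mon a b c i j l : P :=
  'X_x1 ^+ a * 'X_y1 ^+ b * 'X_z2 ^+ c * 'X_x2 ^+ i * 'X_y2 ^+ j * 'X_z1 ^+ l.

Definition mexp a b c i j l : 'X_{1..6} :=
  [multinom nth 0%N [:: a; b; l; i; j; c] k | k < 6].

Lemma monE (m : 'X_{1..6}) :
  'X_[m] = mon (m x1) (m y1) (m z2) (m x2) (m y2) (m z1).
Proof. by rewrite mpolyXE_id big_ord6 /= /mon; ring. Qed.

Lemma mon_mexp a b c i j l : mon a b c i j l = 'X_[mexp a b c i j l].
Proof. by rewrite monE !mnmE. Qed.

Lemma mon_ind (Q : P -> Prop) :
  (forall a b c i j l, Q (mon a b c i j l)) ->
  (forall p q, Q p -> Q q -> Q (p + q)) -> (forall al p, Q p -> Q (al *: p)) ->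
  forall p, Q p.
Proof.
move=> Qm QD QZ p; rewrite (mpolyE p).
apply: big_ind => // [|m _]; last by apply: QZ; rewrite monE.
by rewrite -(scale0r 1); apply: QZ; rewrite -mpolyX0 monE.
Qed.

Lemma mderivXexp (i k : 'I_6) a :
  ('X_i ^+ a)^`M(k) = ((i == k)%:R * a%:R) *: 'X_i ^+ a.-1 :> P.
Proof.
rewrite mpolyXn mderivX mulmnE mnm1E natrM.
case: eqVneq => [->|_]; last by rewrite !mul0r !scale0r.
rewrite !mul1r mpolyXn; case: a => [|a]; first by rewrite !scale0r.
by rewrite /= mulmS addmC addmK.
Qed.

Lemma mderiv_mon a b c i j l (m := mon a b c i j l) :
  (m^`M(x1) = a%:R *: mon a.-1 b c i j l) *
  (m^`M(y1) = b%:R *: mon a b.-1 c i j l) *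
  (m^`M(z1) = l%:R *: mon a b c i j l.-1) *
  (m^`M(x2) = i%:R *: mon a b c i.-1 j l) *
  (m^`M(y2) = j%:R *: mon a b c i j.-1 l) *
  (m^`M(z2) = c%:R *: mon a b c.-1 i j l).
Proof.
rewrite /m /mon !mderivM !mderivXexp /= !mul0r !mul1r !scale0r -!mul_mpolyC.
by do ![split]; ring.
Qed.

Lemma mulX_mon a b c i j l (m := mon a b c i j l) :
  ('X_x1 * m = mon a.+1 b c i j l) *
  ('X_y1 * m = mon a b.+1 c i j l) *
  ('X_z1 * m = mon a b c i j l.+1) *
  ('X_x2 * m = mon a b c i.+1 j l) *
  ('X_y2 * m = mon a b c i j.+1 l) *
  ('X_z2 * m = mon a b c.+1 i j l).
Proof. rewrite /m /mon. do ![split]; rewrite [_ ^+ _.+1]exprS; ring. Qed.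

End Monomials.

(** * The core operator *)

(** Both sides of an intertwining relation have terms with indices k and k + 1
    at the same monomial; this moves one family to the index of the other. *)
Lemma sum_shift (V : nmodType) N (C B : nat -> V) :
  C 0 = 0 -> B N = 0 -> (forall k, C k.+1 = B k) ->
  \sum_(k < N.+1) C k = \sum_(k < N.+1) B k.
Proof.
move=> C0 BN CB; rewrite big_ord_recl big_ord_recr /= C0 BN add0r addr0.
by apply: eq_bigr => k _; rewrite CB.
Qed.

Section Operator.
Variable K : numFieldType.
Local Notation P := {mpoly K[6]}.
Local Notation DM := (fun (i : 'I_6) (p : P) => p^`M(i)).
Local Notation XM := (fun i : 'I_6 => 'X_i : P).
Local Notation mon := (mon K).

Lemma mpoly_partials : partials DM XM.
Proof.
split=> *; rewrite ?mderivD ?mderivZ ?mderivM ?mderivXU //.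
exact: mderiv_comm.
Qed.

Lemma euler_mon a b c i j l (m := mon a b c i j l) :
  ('X_x1 * m^`M(x1) = a%:R *: m) * ('X_y1 * m^`M(y1) = b%:R *: m) *
  ('X_z2 * m^`M(z2) = c%:R *: m).
Proof.
rewrite /m {m} !mderiv_mon -!scalerAr !mulX_mon.
split; first split.
- by case: a => *; rewrite ?scale0r.
- by case: b => *; rewrite ?scale0r.
- by case: c => *; rewrite ?scale0r.
Qed.

Lemma opX_mon q a b c i j l : opX DM XM q (mon a b c i j l) =
  (a%:R + q + 1) *: mon a.+1 b c i j l + c%:R *: mon a b.+1 c.-1 i j l.
Proof.
rewrite -[a%:R + q + 1]addrA /opX euler_mon -scalerDl -scalerAr mulX_mon
  mderiv_mon -scalerAr.
by rewrite mulX_mon.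
Qed.

Lemma opZ_mon r a b c i j l : opZ DM XM r (mon a b c i j l) =
  (c%:R + r + 1) *: mon a b c.+1 i j l + a%:R *: mon a.-1 b.+1 c i j l.
Proof.
rewrite -[c%:R + r + 1]addrA /opZ /opZ0 euler_mon -scalerDl -scalerAr mulX_mon
  mderiv_mon -scalerAr.
by rewrite mulX_mon; apply: addrC.
Qed.

Lemma opH1_mon a b c i j l (m := mon a b c i j l) :
  opH1 DM XM m = (a + b)%:R *: m.
Proof. by rewrite /opH1 !euler_mon -scalerDl natrD. Qed.

Lemma opH2_mon a b c i j l (m := mon a b c i j l) :
  opH2 DM XM m = (b + c)%:R *: m.
Proof. by rewrite /opH2 !euler_mon -scalerDl natrD. Qed.

Lemma opM_mon k a b c i j l : opM DM XM k (mon a b c i j l) =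
  (a%:R * c%:R) *: mon a.-1 b c.-1 i j l
  - (b%:R * (a%:R + b%:R - 1 + c%:R + k)) *: mon a b.-1 c i j l.
Proof.
rewrite /opM /opH1 !mderiv_mon !mderivZ -!scalerAr !euler_mon mderiv_mon.
rewrite !scalerA -!scalerDl; congr (_ - _ *: _).
case: b => [|b]; first by rewrite !mul0r !mulr0 !addr0.
by rewrite /= -natr1; ring.
Qed.

Variables p q r s : K.
(** The conjugated solution.  The relations with [opH1] and [opH2] say that the
    weights a + b and b + c are preserved, which leaves the single summation
    index k; the exponents of y1, x2, y2, z1 do not affect the coefficients
    because multiplications by these variables commute with the operator. *)
Definition core : P -> P := monlift (fun m =>
  \sum_(k < (m x1).+1) coef p q r s (m x1) (m z2) k *:
    mon (m x1 - k) (m y1 + k) (m z2 - k) (m x2) (m y2) (m z1)).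

HB.instance Definition _ := GRing.Linear.on core.

(** Any N > a may be used, because [coef] vanishes for k > a; sums for
    different monomials can thus be compared over a common range. *)
Lemma core_mon N a b c i j l : (a < N)%N ->
  core (mon a b c i j l) = \sum_(k < N) coef p q r s a c k *:
    mon (a - k) (b + k) (c - k) i j l.
Proof.
move=> ltaN; rewrite {1}mon_mexp /core monliftX !mnmE /=.
rewrite (big_ord_widen N (fun k => coef p q r s a c k *:
    mon (a - k) (b + k) (c - k) i j l)) // big_mkcond /=.
apply: eq_bigr => k _; rewrite ltnS; case: leqP => // ltak.
by rewrite coef_gtl ?scale0r.
Qed.

Lemma core1 : core 1 = 1.
Proof.
have -> : 1 = mon 0 0 0 0 0 0 by rewrite /mon !expr0 !mulr1.
rewrite (@core_mon 1) // big_ord1 coef_0 /=.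
by rewrite !rising_ratio0 invr1 !mulr1 scale1r.
Qed.

Let TD u v : core (u + v) = core u + core v. Proof. exact: raddfD. Qed.
Let TZ a u : core (a *: u) = a *: core u. Proof. exact: linearZ. Qed.

Let dE := partialE mpoly_partials.

Lemma core_param f :
  [/\ core ('X_x2 * f) = 'X_x2 * core f, core ('X_y2 * f) = 'X_y2 * core f,
      core ('X_z1 * f) = 'X_z1 * core f & core ('X_y1 * f) = 'X_y1 * core f].
Proof.
elim/mon_ind: f => [a b c i j l|f g [Hf1 Hf2 Hf3 Hf4] [? ? ? ?]|al f [? ? ? ?]].
- rewrite !mulX_mon !(@core_mon a.+1) // !mulr_sumr.
  by split; apply: eq_bigr => k _; rewrite -scalerAr !mulX_mon ?addSn.
- by split; rewrite !(mulrDr, TD); congr (_ + _).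
- by split; rewrite TZ -!scalerAr TZ; congr (_ *: _).
Qed.

Lemma core_deriv f : [/\ core f^`M(x2) = (core f)^`M(x2),
  core f^`M(y2) = (core f)^`M(y2) & core f^`M(z1) = (core f)^`M(z1)].
Proof.
elim/mon_ind: f => [a b c i j l|f g [? ? ?] [? ? ?]|al f [? ? ?]].
- rewrite !mderiv_mon !TZ !(@core_mon a.+1) // !scaler_sumr !raddf_sum.
  by split; apply: eq_bigr => k _; rewrite /= mderivZ mderiv_mon !scalerA mulrC.
- by split; rewrite !(mderivD, TD); congr (_ + _).
- by split; rewrite !(mderivZ, TZ); congr (_ *: _).
Qed.

Let mop_linear (F : P -> P) := (forall u v, F (u + v) = F u + F v) /\
  (forall a u, F (a *: u) = a *: F u).

Let mop_sum F (m : nat) (G : 'I_m -> P) : mop_linear F ->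
  F (\sum_(k < m) G k) = \sum_(k < m) F (G k).
Proof.
move=> [FD FZ]; apply: (big_morph F FD).
by rewrite -(scale0r 0) FZ !scale0r.
Qed.

Let mop_ext F F' : mop_linear F -> mop_linear F' ->
  (forall a b c i j l, core (F (mon a b c i j l)) =
    F' (core (mon a b c i j l))) ->
  forall f, core (F f) = F' (core f).
Proof.
move=> [FD FZ] [FD' FZ'] FF'; elim/mon_ind => // [f g Hf Hg|al f Hf].
- by rewrite FD TD Hf Hg TD FD'.
- by rewrite FZ TZ Hf TZ FZ'.
Qed.

Let lin_opX k : mop_linear (opX DM XM k).
Proof.
by split=> *; rewrite /opX !dE -?mul_mpolyC; ring.
Qed.

Let lin_opZ k : mop_linear (opZ DM XM k).
Proof.
by split=> *; rewrite /opZ /opZ0 !dE -?mul_mpolyC; ring.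
Qed.

Let lin_opH1 : mop_linear (opH1 DM XM).
Proof. by split=> *; rewrite /opH1 !dE -?mul_mpolyC; ring. Qed.

Let lin_opH2 : mop_linear (opH2 DM XM).
Proof. by split=> *; rewrite /opH2 !dE -?mul_mpolyC; ring. Qed.

Let lin_opM k : mop_linear (opM DM XM k).
Proof. by split=> *; rewrite /opM /opH1 !dE -?mul_mpolyC; ring. Qed.

Let coef_natB a c k : coef p q r s a c k * (a - k)%:R =
  coef p q r s a c k * (a%:R - k%:R).
Proof.
by have [ltak|leka] := ltnP a k; [rewrite coef_gtl ?mul0r | rewrite natrB].
Qed.

Let coef_natBr a c k : coef p q r s a c k * (c - k)%:R =
  coef p q r s a c k * (c%:R - k%:R).
Proof.
by have [ltck|lekc] := ltnP c k; [rewrite coef_gtr ?mul0r | rewrite natrB].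
Qed.

Let coef_natBr' a c k : (c%:R - k%:R) * coef p q r s a c k =
  coef p q r s a c k * (c - k)%:R.
Proof. by rewrite coef_natBr mulrC. Qed.

Let coef_natB' a c k : (a%:R - k%:R) * coef p q r s a c k =
  coef p q r s a c k * (a - k)%:R.
Proof. by rewrite coef_natB mulrC. Qed.

Lemma core_opH1 f : core (opH1 DM XM f) = opH1 DM XM (core f).
Proof.
apply: mop_ext => // a b c i j l; rewrite opH1_mon TZ !(@core_mon a.+1) //.
rewrite (mop_sum _ lin_opH1) scaler_sumr; apply: eq_bigr => k _.
rewrite (lin_opH1.2) opH1_mon !scalerA mulrC natrD [in RHS]natrD.
by rewrite mulrDr [in RHS]mulrDr coef_natB natrD -!mulrDr; congr (_ * _ *: _);
  ring.
Qed.

Lemma core_opH2 f : core (opH2 DM XM f) = opH2 DM XM (core f).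
Proof.
apply: mop_ext => // a b c i j l; rewrite opH2_mon TZ !(@core_mon a.+1) //.
rewrite (mop_sum _ lin_opH2) scaler_sumr; apply: eq_bigr => k _.
rewrite (lin_opH2.2) opH2_mon !scalerA mulrC natrD [in RHS]natrD.
by rewrite mulrDr [in RHS]mulrDr coef_natBr natrD -!mulrDr; congr (_ * _ *: _);
  ring.
Qed.

Hypotheses (hq : nonint q) (hr : nonint r).
Hypothesis Hpqrs : s = r + (p - q).

(** C collects the terms in which the exponent of x1 has been raised, B those
    with an exponent of z2 lowered; B k sits at the monomial of C k.+1. *)
Lemma core_opX f : core (opX DM XM q f) = opX DM XM p (core f).
Proof.
apply: mop_ext => // a b c i j l; rewrite opX_mon TD !TZ !(@core_mon a.+2) //.
rewrite (mop_sum _ (lin_opX _)) !scaler_sumr.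
under [in RHS]eq_bigr => k _.
  rewrite (lin_opX _).2 opX_mon scalerDr !scalerA.
  over.
rewrite big_split /=; apply/eqP; rewrite -subr_eq0 opprD addrACA -!sumrB.
rewrite addr_eq0 -sumrN; apply/eqP.
pose E k := mon (a.+1 - k) (b + k) (c - k) i j l.
pose C k := ((a%:R + q + 1) * coef p q r s a.+1 c k
             - (a%:R - k%:R + p + 1) * coef p q r s a c k) *: E k.
pose B k := ((c%:R - k%:R) * coef p q r s a c k
             - c%:R * coef p q r s a c.-1 k) *: E k.+1.
transitivity (\sum_(k < a.+2) C k).
  apply: eq_bigr => k _; rewrite scalerA /C scalerBl; congr (_ - _).
  have [ltak|leka] := ltnP a k.
    by rewrite (coef_gtl _ _ _ _ _ ltak) mulr0 mul0r !scale0r.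
  by rewrite [_ * (_ + p + 1)]mulrC -(natrB K leka) /E (subSn leka).
transitivity (\sum_(k < a.+2) B k).
  apply: sum_shift => [||k].
  - by rewrite /C subr0 coef_opX0 // subrr scale0r.
  - by rewrite /B !coef_gtl // !mulr0 subrr scale0r.
  - rewrite /C /B -coef_opX //; congr (_ *: _); rewrite -natr1; ring.
have E1 k : E k.+1 = mon (a - k) (b + k).+1 (c - k).-1 i j l.
  by rewrite /E subSS addnS subnS.
have E2 k : E k.+1 = mon (a - k) (b.+1 + k) (c.-1 - k) i j l.
  by rewrite E1 -addSn -!subn1 subnAC.
apply: eq_bigr => k _; rewrite opprB /B scalerBl {1}E1 E2 scalerA.
by rewrite coef_natBr'.
Qed.

Lemma core_opZ f : core (opZ DM XM r f) = opZ DM XM s (core f).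
Proof.
apply: mop_ext => // a b c i j l; rewrite opZ_mon TD !TZ !(@core_mon a.+2) //;
  last by rewrite ltnS leqW // leq_pred.
rewrite (mop_sum _ (lin_opZ _)) !scaler_sumr.
under [in RHS]eq_bigr => k _.
  rewrite (lin_opZ _).2 opZ_mon scalerDr !scalerA.
  over.
rewrite big_split /=; apply/eqP; rewrite -subr_eq0 opprD addrACA -!sumrB.
rewrite addr_eq0 -sumrN; apply/eqP.
pose E k := mon (a - k) (b + k) (c.+1 - k) i j l.
pose C k := ((c%:R + r + 1) * coef p q r s a c.+1 k
             - (c%:R - k%:R + s + 1) * coef p q r s a c k) *: E k.
pose B k := ((a%:R - k%:R) * coef p q r s a c k
             - a%:R * coef p q r s a.-1 c k) *: E k.+1.
transitivity (\sum_(k < a.+2) C k).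
  apply: eq_bigr => k _; rewrite scalerA /C scalerBl; congr (_ - _).
  have [ltck|lekc] := ltnP c k.
    by rewrite (coef_gtr _ _ _ _ _ ltck) mulr0 mul0r !scale0r.
  by rewrite [_ * (_ + s + 1)]mulrC -(natrB K lekc) /E (subSn lekc).
transitivity (\sum_(k < a.+2) B k).
  apply: sum_shift => [||k].
  - by rewrite /C subr0 coef_opZ0 // subrr scale0r.
  - by rewrite /B !coef_gtl ?mulr0 ?subrr ?scale0r // ltnS leq_pred.
  - rewrite /C /B -coef_opZ //; congr (_ *: _); rewrite -natr1; ring.
have E1 k : E k.+1 = mon (a - k).-1 (b + k).+1 (c - k) i j l.
  by rewrite /E subSS addnS subnS.
have E2 k : E k.+1 = mon (a.-1 - k) (b.+1 + k) (c - k) i j l.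
  by rewrite E1 -addSn -!subn1 subnAC.
apply: eq_bigr => k _; rewrite opprB /B scalerBl {1}E1 E2 scalerA.
by rewrite coef_natB' .
Qed.

Lemma core_opM f :
  core (opM DM XM (p + r + 2) f) = opM DM XM (p + r + 2) (core f).
Proof.
apply: mop_ext => // a b c i j l; rewrite opM_mon TD -scaleNr !TZ.
rewrite !(@core_mon a.+2) ?ltnS ?leqW ?leq_pred //.
rewrite (mop_sum _ (lin_opM _)) !scaler_sumr.
under [in RHS]eq_bigr => k _.
  rewrite (lin_opM _).2 opM_mon -scaleNr scalerDr !scalerA.
  over.
rewrite big_split /=; apply/eqP; rewrite -subr_eq0 opprD addrACA -!sumrB.
rewrite addrC addr_eq0 -sumrN; apply/eqP.
pose E k := mon (a - k) (b + k).-1 (c - k) i j l.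
pose C k := (k%:R * (a%:R + c%:R - k%:R + 1 + (p + r)) * coef p q r s a c k)
             *: E k.
pose B k := - (a%:R * c%:R * coef p q r s a.-1 c.-1 k -
  (a%:R - k%:R) * (c%:R - k%:R) * coef p q r s a c k) *: E k.+1.
transitivity (\sum_(k < a.+2) C k).
  apply: eq_bigr => k _.
  have Eb z : - (b%:R * z) *: (coef p q r s a c k *:
      mon (a - k) (b.-1 + k) (c - k) i j l)
      = (- (b%:R * z) * coef p q r s a c k) *: E k.
    by rewrite scalerA /E; case: (b) => [|//];
      rewrite mul0r oppr0 mul0r !scale0r.
  rewrite Eb -/(E k) -scalerBl /C; congr (_ *: _).
  have [ltak|leka] := ltnP a k; first by rewrite (coef_gtl _ _ _ _ _ ltak);
    ring.
  have [ltck|lekc] := ltnP c k; first by rewrite (coef_gtr _ _ _ _ _ ltck);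
    ring.
  by rewrite !natrD !natrB //; ring.
transitivity (\sum_(k < a.+2) B k).
  apply: sum_shift => [||k].
  - by rewrite /C !mul0r scale0r.
  - by rewrite /B !coef_gtl ?ltnS ?leq_pred // !mulr0 subrr oppr0 scale0r.
  - rewrite /C /B coef_opM // opprK; congr (_ *: _); rewrite -natr1; ring.
have E1 k : E k.+1 = mon (a - k).-1 (b + k) (c - k).-1 i j l.
  by rewrite /E addnS !subnS.
have E2 k : E k.+1 = mon (a.-1 - k) (b + k) (c.-1 - k) i j l.
  by rewrite /E addnS -!subn1 !(subnAC _ 1) !subn1 !subnS.
apply: eq_bigr => k _; rewrite -E1 -E2 scalerA -scalerBl -scaleNr /B.
congr (- _ *: _); rewrite mulrA coef_natB (mulrAC (coef _ _ _ _ _ _ _)).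
rewrite coef_natBr; ring.
Qed.

Lemma core_satisfies u1 u2 a2 a3 : q = u1 - u2 -> p = u1 - a2 ->
  r = a2 - a3 -> s = u2 - a3 -> core_relations DM XM u1 u2 a2 a3 core.
Proof.
move=> eq_q eq_p eq_r eq_s; split=> *; rewrite -?eq_q -?eq_p -?eq_r -?eq_s //.
- exact: core_param.
- exact: core_deriv.
- exact: core_opH1.
- exact: core_opH2.
- exact: core_opX.
- exact: core_opZ.
Qed.

End Operator.

(** * Uniqueness from the core relations *)

Section Uniqueness.
Variable K : numFieldType.
Local Notation P := {mpoly K[6]}.
Local Notation DM := (fun (i : 'I_6) (p : P) => p^`M(i)).
Local Notation XM := (fun i : 'I_6 => 'X_i : P).
Variables u1 u2 a2 a3 : K.

(** Euler operators are diagonal on monomials, so their kernels can be read off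
    from the supports. *)
Lemma mcoeff_euler (i : 'I_6) (f : P) m :
  ('X_i * f^`M(i))@_m = (m i)%:R * f@_m.
Proof.
elim/mpolyind: f => [|c n f _ _ IH];
  first by rewrite mderiv0 mulr0 mcoeff0 mulr0.
rewrite mderivD mulrDr !mcoeffD IH mulrDr; congr (_ + _).
rewrite mderivZ mderivX -!scalerAr -mpolyXD !mcoeffZ !mcoeffX.
have [ni0|ni] := posnP (n i).
  rewrite ni0 mul0r mulr0; case: eqVneq => [<-|_]; last by rewrite !mulr0.
  by rewrite ni0 mul0r.
have -> : (U_(i) + (n - U_(i)))%MM = n.
  by rewrite addmC submK // lep1mP -lt0n.
by case: eqVneq => [<-|_]; rewrite ?mulr0 // !mulr1 mulrC.
Qed.

(** T 1 is annihilated by three derivatives and by two Euler operators with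
    nonnegative weights; together these leave no monomial other than 1. *)
Lemma core_relations_1 T : core_relations DM XM u1 u2 a2 a3 T ->
  T 1 = ((T 1)@_0)%:MP.
Proof.
move=> HT; have T0 : T 0 = 0 by rewrite -(scale0r 0) (intwZ HT) !scale0r.
have [dx2 dy2 dz1] := intw_deriv HT 1.
have H1 := intw_opH1 HT 1; have H2 := intw_opH2 HT 1.
rewrite /opH1 /opH2 /= !mderiv1 ?mulr0 ?addr0 T0 in dx2 dy2 dz1 H1 H2.
apply/mpolyP => m; rewrite mcoeffC; case: eqVneq => [->|m0].
  by rewrite mulr1.
rewrite mulr0; apply/eqP; apply: contraNT m0 => Tm0.
have kill (n : nat) : n%:R * (T 1)@_m = 0 -> n = 0%N.
  by move/eqP; rewrite mulf_eq0 (negPf Tm0) orbF pnatr_eq0 => /eqP.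
have mx2 : m x2 = 0%N by apply: kill; rewrite -mcoeff_euler -dx2 mulr0 mcoeff0.
have my2 : m y2 = 0%N by apply: kill; rewrite -mcoeff_euler -dy2 mulr0 mcoeff0.
have mz1 : m z1 = 0%N by apply: kill; rewrite -mcoeff_euler -dz1 mulr0 mcoeff0.
have /eqP : (m x1 + m y1 = 0)%N.
  by apply: kill; rewrite natrD mulrDl -!mcoeff_euler -mcoeffD -H1 mcoeff0.
have /eqP : (m y1 + m z2 = 0)%N.
  by apply: kill; rewrite natrD mulrDl -!mcoeff_euler -mcoeffD -H2 mcoeff0.
rewrite !addn_eq0 => /andP[/eqP my1 /eqP mz2] /andP[/eqP mx1 _].
by apply/eqP/mnmP => i; rewrite mnm0E; elim/ord6P: i.
Qed.

(** The vectors on which T' and c T agree form a subspace stable under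
    multiplication by x2, y2, z1, y1 and under [opX] and [opZ].  [opX] raises
    the exponent of x1 in x1^a by a factor a + q + 1 <> 0; [opZ] raises the
    exponent of z2 by a factor c + r + 1 <> 0, up to a multiple of y1. *)
Lemma core_relations_unique T T' c :
  nonint (u1 - u2) -> nonint (a2 - a3) ->
  core_relations DM XM u1 u2 a2 a3 T ->
  core_relations DM XM u1 u2 a2 a3 T' ->
  T' 1 = c *: T 1 -> forall f, T' f = c *: T f.
Proof.
move=> hq hr HT HT' T1.
pose Q f := T' f = c *: T f.
have QD f g : Q f -> Q g -> Q (f + g).
  by rewrite /Q => Hf Hg; rewrite (intwD HT) (intwD HT') Hf Hg scalerDr.
have QZ a f : Q f -> Q (a *: f).
  by rewrite /Q => Hf; rewrite (intwZ HT) (intwZ HT') Hf !scalerA mulrC.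
have QZK a f : a != 0 -> Q (a *: f) -> Q f.
  by move=> a0 /(QZ a^-1); rewrite scalerA mulVf // scale1r.
have Qmul f : Q f ->
    [/\ Q ('X_x2 * f), Q ('X_y2 * f), Q ('X_z1 * f) & Q ('X_y1 * f)].
  rewrite /Q => Hf.
  have [-> -> -> ->] := intw_param HT f; have [-> -> -> ->] := intw_param HT' f.
  by rewrite Hf -!scalerAr.
have QopX f : Q f -> Q (opX DM XM (u1 - u2) f).
  rewrite /Q (intw_opX HT) (intw_opX HT') => ->;
    rewrite /opX /= !mderivZ -!mul_mpolyC.
  ring.
have QopZ f : Q f -> Q (opZ DM XM (a2 - a3) f).
  rewrite /Q (intw_opZ HT) (intw_opZ HT') => ->.
  rewrite /opZ /opZ0 /= !mderivZ -!mul_mpolyC; ring.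
have Qx a : Q (mon K a 0 0 0 0 0).
  elim: a => [|a IH]; first by rewrite /mon !expr0 !mulr1.
  have := QopX _ IH; rewrite opX_mon scale0r addr0; apply: QZK.
  by rewrite -addrA addrC nonint_neq0 //; apply: nonintD1.
have Qxz c' a : Q (mon K a 0 c' 0 0 0).
  elim: c' a => [|n IH] a; first exact: Qx.
  have Qy : Q (- (a%:R *: mon K a.-1 1 n 0 0 0)).
    rewrite -scaleNr; apply: QZ.
    by have [_ _ _] := Qmul _ (IH a.-1); rewrite mulX_mon.
  have := QD _ _ (QopZ _ (IH a)) Qy; rewrite opZ_mon addrK; apply: QZK.
  by rewrite -addrA addrC nonint_neq0 //; apply: nonintD1.
elim/mon_ind => // a b n i j l.
elim: l => [|l IHl]; last by have [_ _] := Qmul _ IHl; rewrite mulX_mon.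
elim: j => [|j IHj]; last by have [_] := Qmul _ IHj; rewrite mulX_mon.
elim: i => [|i IHi]; last by have [] := Qmul _ IHi; rewrite mulX_mon.
elim: b => [|b IHb]; last by have [_ _ _] := Qmul _ IHb; rewrite mulX_mon.
exact: Qxz.
Qed.
End Uniqueness.

(** * Estimates for the exponential *)

Section RealEstimates.
Variable R : realType.
Implicit Types a b x : R.

(** From 1 + a <= exp a and, at - a, exp a * (1 - a) <= 1. *)
Lemma expR_quad a : `|a| <= 1/2 -> `|expR a - 1 - a| <= 2 * a ^+ 2.
Proof.
rewrite ler_norml => /andP[a1 a2].
have e1 := expR_ge1Dx a; have e2 := expR_ge1Dx (- a).
have e0 := expR_gt0 a.
have : expR a * (1 - a) <= 1.
  by rewrite -[leRHS](expRxMexpNx_1 a) ler_pM2l.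
move=> e3; rewrite ger0_norm; last by lra.
rewrite -subr_ge0.
have -> : 2 * a ^+ 2 - (expR a - 1 - a) = 1 + a + 2 * a ^+ 2 - expR a by ring.
rewrite subr_ge0 -(ler_pM2r (_ : 0 < 1 - a)); last by lra.
apply: (le_trans e3); nra.
Qed.

(** By the mean value theorem, which then turns this bound into the one for
    cosine, and that one into the second-order bound for sine. *)
Lemma sin_norm_le b : `|sin b| <= `|b|.
Proof.
wlog b0 : b / 0 <= b => [H|].
  have [/H//|b0] := leP 0 b.
  by rewrite -normrN -sinN -(normrN b) H // oppr_ge0 ltW.
have [c _] := MVT_segment b0 (fun x _ => is_derive_sin x)
  (continuous_subspaceT (@continuous_sin R)).
by rewrite sin0 !subr0 => ->; rewrite normrM ler_piMl // cos_max.
Qed.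

Lemma cos_norm_le b : `|cos b - 1| <= b ^+ 2.
Proof.
wlog b0 : b / 0 <= b => [H|].
  have [/H//|b0] := leP 0 b.
  by rewrite -(cosN b) -sqrrN H // oppr_ge0 ltW.
have [c /itvP cI E] := MVT_segment b0 (fun x _ => is_derive_cos x)
  (continuous_subspaceT (@continuous_cos R)).
rewrite cos0 subr0 in E; rewrite E mulNr normrN normrM expr2.
rewrite (ger0_norm b0) ler_wpM2r // (le_trans (sin_norm_le c)) //.
by rewrite ger0_norm ?cI.
Qed.

Lemma sin_norm_quad b : `|b| <= 1 -> `|sin b - b| <= b ^+ 2.
Proof.
wlog b0 : b / 0 <= b => [H|].
  have [/H//|b0 b1] := leP 0 b.
  have := H (- b); rewrite oppr_ge0 normrN sinN sqrrN -opprD normrN.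
  by apply => //; exact: ltW.
move=> b1.
have df (x : R) : x \in `]0, b[ ->
  is_derive x 1 (fun x => sin x - x) (cos x - 1).
  by move=> _; apply: is_deriveB.
have cf : {within `[0, b], continuous (fun x : R => sin x - x)}.
  apply: continuous_subspaceT => x; apply: cvgB; first exact: continuous_sin.
  exact: cvg_id.
have [c /itvP cI] := MVT_segment b0 df cf; rewrite sin0 !subr0 => ->.
rewrite normrM (ger0_norm b0) expr2 ler_wpM2r //.
rewrite (le_trans (cos_norm_le c)) //.
have c0 : 0 <= c by rewrite cI.
have cb : c <= b by rewrite cI.
by rewrite ger0_norm // in b1; nra.
Qed.

End RealEstimates.

Section ComplexLimits.
Variable R : realType.
Local Notation C := R[i].
Local Notation Re := complex.Re.
Local Notation Im := complex.Im.
Implicit Types (z w : C).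

Lemma normc_ge0 z : 0 <= normc z.
Proof. by case: z => a b; exact: sqrtr_ge0. Qed.

Lemma normc_Re_le z : `|Re z| <= normc z.
Proof.
case: z => a b /=; rewrite -sqrtr_sqr ler_wsqrtr // lerDl; exact: sqr_ge0.
Qed.

Lemma normc_Im_le z : `|Im z| <= normc z.
Proof.
case: z => a b /=; rewrite -sqrtr_sqr ler_wsqrtr // lerDr; exact: sqr_ge0.
Qed.

Lemma normc_le_ReIm z : normc z <= `|Re z| + `|Im z|.
Proof.
case: z => a b /=; rewrite -[leRHS]ger0_norm ?addr_ge0 // -sqrtr_sqr ler_wsqrtr
  //.
rewrite sqrrD !real_normK ?num_real // addrAC lerDl mulrn_wge0 // mulr_ge0 //.
Qed.

(** The complex exponential, in the form in which powers of integers are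
    defined. *)
Definition cexp w : C := (expR (Re w) * cos (Im w)) +i* (expR (Re w) *
  sin (Im w)).

Lemma cexpD z w : cexp (z + w) = cexp z * cexp w.
Proof.
case: z w => [a b] [c d]; rewrite /cexp /= expRD cosD sinD.
by apply/eqP; rewrite eq_complex /=; apply/andP; split; apply/eqP; ring.
Qed.

Lemma cexp_quad w : normc w <= 1/2 ->
  normc (cexp w - 1 - w) <= 4 * normc w ^+ 2.
Proof.
move=> w1.
have a1 := le_trans (normc_Re_le w) w1; have b1 := le_trans (normc_Im_le w) w1.
have -> : normc w ^+ 2 = Re w ^+ 2 + Im w ^+ 2.
  by case: w {a1 b1 w1} => a b /=; rewrite sqr_sqrtr // addr_ge0 ?sqr_ge0.
apply: (le_trans (normc_le_ReIm _)); case: w {w1} a1 b1 => a b /= a1 b1.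
rewrite !subr0.
have ea := expR_quad a1; have sb := sin_norm_le b; have cb := cos_norm_le b.
have s3 : `|sin b - b| <= b ^+ 2 by apply: sin_norm_quad; lra.
have -> : expR a * cos b - 1 - a = expR a * (cos b - 1) + (expR a - 1 - a) by
  ring.
have -> : expR a * sin b - b = (expR a - 1 - a + a) * sin b + (sin b - b) by
  ring.
set e := expR a - 1 - a in ea *.
have Ea : `|expR a| <= 2.
  have -> : expR a = e + 1 + a by rewrite /e; ring.
  apply: (le_trans (ler_normD _ _));
    rewrite (le_trans (lerD (ler_normD _ _) (lexx _))) //.
  rewrite normr1; move: a1 ea; rewrite -(real_normK (num_real a)).
  move: `|a| (normr_ge0 a) `|e| => x x0 y; nra.
apply: (le_trans (lerD (ler_normD _ _) (ler_normD _ _))); rewrite !normrM.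
have h1 := ler_pM (normr_ge0 _) (normr_ge0 _) Ea cb.
have h2 : `|e + a| <= 2 * `|a|.
  apply: (le_trans (ler_normD _ _)); move: a1 ea;
    rewrite -(real_normK (num_real a)).
  move: `|a| (normr_ge0 a) `|e| => x x0 y; nra.
have h3 := ler_pM (normr_ge0 _) (normr_ge0 _) h2 sb.
have h4 : 2 * `|a| * `|b| <= a ^+ 2 + b ^+ 2.
  rewrite -(real_normK (num_real a)) -(real_normK (num_real b)).
  have := sqr_ge0 (`|a| - `|b|); nra.
by have := sqr_ge0 b; have := sqr_ge0 a; lra.
Qed.

End ComplexLimits.

(** * Infinite products *)

Definition tends (K : numFieldType) (u : nat -> K) (l : K) : Prop :=
  u @ \oo --> l.

Lemma tends_clim (K : numFieldType) (u : nat -> K) (l : K) :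
  tends u l -> clim u = l.
Proof. by move=> ul; apply: cvg_lim => //; apply: norm_hausdorff. Qed.

Lemma tendsM (K : numFieldType) (u v : nat -> K) (l m : K) :
  tends u l -> tends v m -> tends (fun n => u n * v n) (l * m).
Proof. exact: cvgM. Qed.

Lemma tends_eventually (K : numFieldType) (u v : nat -> K) (l : K) N :
  (forall n, (N <= n)%N -> u n = v n) -> tends u l -> tends v l.
Proof.
move=> uv; apply: cvg_trans; apply: near_eq_cvg.
by exists N => // n /= Nn; rewrite uv.
Qed.

Lemma tends_cst (K : numFieldType) (l : K) : tends (fun=> l) l.
Proof. exact: cvg_cst. Qed.

Lemma tendsP (K : numFieldType) (u : nat -> K) (l : K) :
  (forall e, 0 < e -> exists N, forall n, (N <= n)%N -> `|l - u n| < e) ->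
  tends u l.
Proof.
by move=> h; apply/cvgrPdist_lt => e /h[N hN]; exists N => // n /= /hN.
Qed.

Section Products.
Variable R : realType.
Local Notation C := R[i].
Local Notation Re := complex.Re.
Local Notation Im := complex.Im.
Implicit Types (z w : C).

Lemma tends_normc (u : nat -> C) (l : C) :
  (normc (l - u n) @[n --> \oo] --> (0 : R)) -> tends u l.
Proof.
move=> /cvgrPdist_lt h; apply: tendsP => e e0.
have [/eqP Ie Re0] : Im e == 0 /\ 0 < Re e by move: e0; rewrite ltcE => /andP[].
have [N _ hN] := h _ Re0; exists N => n /hN /=.
have -> : e = (Re e)%:C by case: e e0 Ie Re0 hN => a b /= _ ->.
have -> : `|l - u n| = (normc (l - u n))%:C by [].
by rewrite ltcR sub0r normrN ger0_norm // normc_ge0.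
Qed.

Lemma cvgc_ReIm (u : nat -> C) (a b : R) :
  Re (u n) @[n --> \oo] --> a -> Im (u n) @[n --> \oo] --> b ->
  normc ((a +i* b) - u n) @[n --> \oo] --> (0 : R).
Proof.
move=> /cvgrPdist_lt ha /cvgrPdist_lt hb; apply/cvgrPdist_lt => e e0.
have e2 : 0 < e / 2 by rewrite divr_gt0.
near=> n.
rewrite sub0r normrN ger0_norm ?normc_ge0 //.
apply: (le_lt_trans (normc_le_ReIm _)).
have ha' : `|a - Re (u n)| < e / 2 by near: n; exact: ha.
have hb' : `|b - Im (u n)| < e / 2 by near: n; exact: hb.
by move: ha' hb'; case: (u n) => c d /=; lra.
Unshelve. all: by end_near. Qed.

(** n |-> a n - B d n is nondecreasing and bounded, and B d n tends to 0. *)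
Lemma small_increments_cvg (a d : R ^nat) (B M : R) : 0 <= B ->
  d @ \oo --> (0 : R) ->
  (forall n, 0 <= d n) -> (forall n, a n <= M) ->
  (forall n, `|a n.+1 - a n| <= B * (d n - d n.+1)) -> cvgn a.
Proof.
move=> B0 dlim d0 aM ad.
have cv : cvgn (fun n => a n - B * d n).
  apply: nondecreasing_is_cvgn.
    apply/nondecreasing_seqP => n; have := ad n; rewrite ler_norml; lra.
  exists M => _ [n _ <-]; have := aM n; have := mulr_ge0 B0 (d0 n); lra.
have -> : a = (fun n => (a n - B * d n) + B * d n) by apply/funext => n; lra.
apply: is_cvgD => //; apply: is_cvgMr; exact: (cvgP _ dlim).
Qed.

(** Infinite products with summable deviations |rho n - 1|, the sums being
    majorized by differences of a sequence d.  Since 1 + x <= exp x, the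
    quantity |t n| exp (d n) is nonincreasing; since 1 - x >= exp (- 2 x) for
    0 <= x <= 1/2, the quantity |t n| exp (- 2 d n) is nondecreasing.  Hence
    |t n| stays between two positive constants: the upper one makes the
    increments of t summable, the lower one keeps the limit away from 0. *)
Lemma cvg_infinite_product (t rho : nat -> C) (d : R ^nat) :
  d @ \oo --> (0 : R) -> (forall n, 0 <= d n) -> d 0%N <= 1/2 ->
  (forall n, d n.+1 <= d n) ->
  t 0%N != 0 -> (forall n, t n.+1 = t n * rho n) ->
  (forall n, normc (rho n - 1) <= d n - d n.+1) ->
  exists2 l, l != 0 & tends t l.
Proof.
move=> dlim d0 dhalf dS t0 tS rho1.
have dle n : d n <= 1/2.
  by elim: n => // n; apply: le_trans.
have rhoU n : normc (rho n) <= 1 + (d n - d n.+1).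
  have -> : rho n = 1 + (rho n - 1) by rewrite addrC subrK.
  by apply: (le_trans (le_normcD _ _)); rewrite normc1 lerD2l.
have rhoL n : 1 - (d n - d n.+1) <= normc (rho n).
  have := le_normcD (rho n) (1 - rho n).
  have -> : rho n + (1 - rho n) = 1 by rewrite addrC subrK.
  have -> : normc (1 - rho n) = normc (rho n - 1) by rewrite -normcN opprB.
  rewrite normc1; have := rho1 n; lra.
pose B := normc (t 0%N) * expR (d 0%N).
pose b := normc (t 0%N) * expR (- (2 * d 0%N)).
have b0 : 0 < b.
  rewrite mulr_gt0 ?expR_gt0 // lt_def normc_ge0 andbT.
  by apply: contra t0 => /eqP/eq0_normc ->.
have tU n : normc (t n) * expR (d n) <= B.
  elim: n => // n; apply: le_trans;
    rewrite tS normcM -mulrA ler_wpM2l ?normc_ge0 //.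
  have -> : expR (d n) = expR (d n - d n.+1) * expR (d n.+1).
    by rewrite -expRD subrK.
  rewrite ler_wpM2r ?expR_ge0 //.
  exact: le_trans (rhoU n) (expR_ge1Dx _).
have tL n : b <= normc (t n) * expR (- (2 * d n)).
  elim: n => // n /le_trans; apply; rewrite tS normcM -mulrA.
  rewrite ler_wpM2l ?normc_ge0 //.
  have -> : expR (- (2 * d n)) = expR (- (2 * (d n - d n.+1))) * expR (- (2 * d
    n.+1)).
    by rewrite -expRD; congr expR; ring.
  rewrite ler_wpM2r ?expR_ge0 //; apply: le_trans (rhoL n).
  set x := d n - d n.+1.
  have x0 : 0 <= x by rewrite subr_ge0.
  have x1 : x <= 1/2 by have := dle n; have := d0 n.+1; rewrite /x; lra.
  have ex := expR_ge1Dx (2 * x); have e0 := expR_gt0 (- (2 * x)).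
  have e1 : expR (2 * x) * expR (- (2 * x)) = 1 := expRxMexpNx_1 _.
  have : (1 + 2 * x) * expR (- (2 * x)) <= 1 by rewrite -[leRHS]e1 ler_pM2r.
  move: (expR (- (2 * x))) e0 => y y0 h.
  have : (1 + 2 * x) * y <= (1 + 2 * x) * (1 - x) by apply: (le_trans h); nra.
  by rewrite ler_pM2l //; lra.
have tB n : normc (t n) <= B.
  apply: le_trans (tU n); rewrite ler_peMr ?normc_ge0 //.
  have := expR_ge1Dx (d n); have := d0 n; lra.
have tb n : b <= normc (t n).
  apply: le_trans (tL n) _; rewrite ler_piMr ?normc_ge0 // expR_le1.
  by have := d0 n; lra.
have B0 : 0 <= B := le_trans (normc_ge0 _) (tB 0%N).
have dt n : normc (t n.+1 - t n) <= B * (d n - d n.+1).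
  have -> : t n.+1 - t n = t n * (rho n - 1) by rewrite tS mulrBr mulr1.
  by rewrite normcM ler_pM ?normc_ge0.
have ReB (x y : C) : Re (x - y) = Re x - Re y by case: x y => [? ?] [? ?].
have ImB (x y : C) : Im (x - y) = Im x - Im y by case: x y => [? ?] [? ?].
have /cvg_ex[/= p hp] : cvgn (fun n => Re (t n)).
  apply: (small_increments_cvg B0 dlim d0 (M := B)) => n.
    exact: le_trans (ler_norm _) (le_trans (normc_Re_le _) (tB n)).
  by rewrite -ReB; apply: le_trans (normc_Re_le _) (dt n).
have /cvg_ex[/= q hq] : cvgn (fun n => Im (t n)).
  apply: (small_increments_cvg B0 dlim d0 (M := B)) => n.
    exact: le_trans (ler_norm _) (le_trans (normc_Im_le _) (tB n)).
  by rewrite -ImB; apply: le_trans (normc_Im_le _) (dt n).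
have hl := cvgc_ReIm hp hq.
exists (p +i* q); last exact: tends_normc.
apply/eqP => l0; move/cvgrPdist_lt : hl => /(_ b b0);
  rewrite l0 => -[N _ /(_ N (leqnn N))].
rewrite /= !sub0r normcN normrN ger0_norm ?normc_ge0 //.
by rewrite ltNge tb.
Qed.
End Products.

(** * The Gamma function as Euler's limit *)

Section GammaFunction.
Variable R : realType.
Local Notation C := R[i].
Local Notation Re := complex.Re.
Local Notation Im := complex.Im.
Implicit Types (z w : C).

Definition gamma_term z n : C :=
  n`!%:R * npowc n z / \prod_(k < n.+1) (z + k%:R).

Lemma GammaE z : Gamma z = clim (gamma_term z). Proof. by []. Qed.

Lemma npowcE n z : npowc n z = cexp (z * (ln n%:R)%:C).
Proof.
by case: z => a b; rewrite /npowc /cexp /= !mulr0 subr0 add0r.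
Qed.

Lemma normc_real (x : R) : normc x%:C = `|x|.
Proof. by rewrite /= expr0n addr0 sqrtr_sqr. Qed.

Lemma real_complex_nat n : n%:R = (n%:R : R)%:C :> C.
Proof. by rewrite rmorph_nat. Qed.

Lemma normc_nat n : normc (n%:R : C) = n%:R.
Proof. by rewrite real_complex_nat normc_real ger0_norm. Qed.

(** Quotient of consecutive terms of Euler's limit. *)
Definition gamma_step z n : C :=
  n.+1%:R * cexp (z * (ln n.+1%:R - ln n%:R)%:C) / (z + n.+1%:R).

Lemma gamma_termS z n : (0 < n)%N ->
  gamma_term z n.+1 = gamma_term z n * gamma_step z n.
Proof.
move=> n0; rewrite /gamma_term /gamma_step big_ord_recr /= factS natrM !npowcE.
have -> : (ln n.+1%:R)%:C = (ln n%:R)%:C + (ln n.+1%:R - ln n%:R)%:C :> C.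
  by rewrite -rmorphD /= addrC subrK.
rewrite mulrDr cexpD invfM; ring.
Qed.

Lemma ln_succ_bounds n : (0 < n)%N ->
  (n.+1%:R : R)^-1 <= ln (n.+1%:R : R) - ln (n%:R : R) <= (n%:R)^-1.
Proof.
move=> n0; have pn : 0 < n%:R :> R by rewrite ltr0n.
have pn1 : 0 < n.+1%:R :> R by rewrite ltr0n.
apply/andP; split.
  rewrite -lerN2 opprB -ln_div ?posrE //.
  have -> : n%:R / n.+1%:R = 1 + - (n.+1%:R)^-1 :> R.
    by rewrite -natr1; field; rewrite natr1; apply: lt0r_neq0.
  apply: le_ln1Dx; rewrite ltrN2 invf_lt1 // ltr1n ltnS //.
rewrite -ln_div ?posrE //.
have -> : n.+1%:R / n%:R = 1 + (n%:R)^-1 :> R.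
  by rewrite -natr1; field; apply: lt0r_neq0.
by apply: le_ln1Dx; apply: lt_trans (_ : 0 < _); rewrite ?invr_gt0 // ltrN10.
Qed.

(** With s = ln (n + 1) - ln n and w = z s the quotient minus 1 is
    ((n + 1) (exp w - 1 - w) + z (s (n + 1) - 1)) / (z + n + 1).  As s lies
    between 1 / (n + 1) and 1 / n, the numerator is O(1/n), and the whole is
    O(1 / (n (n + 1))), a telescoping majorant. *)
Lemma gamma_step_le z n (A := normc z) : (0 < n)%N -> 2 * A <= n%:R ->
  normc (gamma_step z n - 1) <=
  (16 * A ^+ 2 + 2 * A) * ((n%:R)^-1 - (n.+1%:R)^-1).
Proof.
move=> n0 An; have A0 : 0 <= A := normc_ge0 z.
have /andP[sl su] := ln_succ_bounds n0.
rewrite /gamma_step; move: (ln _ - ln _) sl su => s sl su.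
pose N : R := n%:R; have N0 : 0 < N by rewrite ltr0n.
have eN : n.+1%:R = N + 1 :> R by rewrite natr1.
rewrite eN -/N in sl su An *.
have s0 : 0 <= s by apply: le_trans sl; rewrite invr_ge0; lra.
have sN : s * N <= 1 by rewrite -ler_pdivlMr // div1r.
have sN1 : 1 <= s * (N + 1) by rewrite -ler_pdivrMr ?div1r //; lra.
set w := z * s%:C.
have nw : normc w = A * s by rewrite /w normcM normc_real ger0_norm.
have w1 : normc w <= 1/2 by rewrite nw; nra.
have ew := cexp_quad w1; rewrite nw in ew.
pose D := z + n.+1%:R.
have nD : N + 1 <= 2 * normc D.
  have := le_normcD D (- z); rewrite normcN.
  have -> : D + - z = n.+1%:R by rewrite /D addrAC subrr add0r.
  rewrite normc_nat eN -/A; lra.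
have D0 : D != 0.
  by apply/eqP => D0; move: nD; rewrite D0 normc0; lra.
have -> : n.+1%:R * cexp w / D - 1 =
   (n.+1%:R * (cexp w - 1 - w) + z * (s * (N + 1) - 1)%:C) / D.
  have NC : N%:C = n%:R :> C by rewrite real_complex_nat.
  rewrite rmorphB rmorphM rmorphD /= rmorph1. rewrite NC /w.
  rewrite /D -natr1; field.
  by rewrite natr1 -/D.
rewrite normcM normcV.
have num : normc (n.+1%:R * (cexp w - 1 - w) + z * (s * (N + 1) - 1)%:C) <=
   (N + 1) * (4 * (A * s) ^+ 2) + A * (s * (N + 1) - 1).
  apply: (le_trans (le_normcD _ _)); rewrite !normcM normc_nat normc_real eN.
  rewrite (ger0_norm (_ : 0 <= s * (N + 1) - 1)) -/A; last by lra.
  by rewrite lerD2r ler_wpM2l //; lra.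
have pD : 0 < normc D by lra.
rewrite ler_pdivrMr //; apply: (le_trans num).
have -> : N^-1 - (N + 1)^-1 = (N * (N + 1))^-1.
  field; apply/andP; split; apply: lt0r_neq0; lra.
have p2 : 0 < N * (N + 1) by rewrite mulr_gt0 //; lra.
rewrite mulrAC ler_pdivlMr //.
have As0 : 0 <= A * s by rewrite mulr_ge0.
have AsN : A * s * N <= A by rewrite -mulrA ler_piMr.
have h1 : (A * s) ^+ 2 * N ^+ 2 <= A ^+ 2.
  by rewrite -exprMn ler_pXn2r // nnegrE // mulr_ge0 // ltW.
have h2 : (s * (N + 1) - 1) * N <= 1 by nra.
have N1 : 1 <= N by rewrite ler1n.
have q1 : (N + 1) * (4 * (A * s) ^+ 2) * (N * (N + 1)) <= 16 * A ^+ 2 * normc D.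
  have -> : (N + 1) * (4 * (A * s) ^+ 2) * (N * (N + 1)) =
    4 * ((A * s) ^+ 2 * N * (N + 1)) * (N + 1) by ring.
  have g1 : (A * s) ^+ 2 * N * (N + 1) <= 2 * A ^+ 2.
    have := sqr_ge0 (A * s); move: ((A * s) ^+ 2) h1 => y h1 y0; nra.
  have := sqr_ge0 A; move: (A ^+ 2) g1 => a2; move: (_ * N * (N + 1)) => x; nra.
have q2 : A * (s * (N + 1) - 1) * (N * (N + 1)) <= 2 * A * normc D.
  have -> : A * (s * (N + 1) - 1) * (N * (N + 1)) =
    A * ((s * (N + 1) - 1) * N) * (N + 1) by ring.
  have g : 0 <= (s * (N + 1) - 1) * N by rewrite mulr_ge0 //; lra.
  have g1 : A * ((s * (N + 1) - 1) * N) <= A by rewrite ler_piMr.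
  have := ler_wpM2r (_ : 0 <= N + 1) g1; have := ler_wpM2l A0 nD; lra.
rewrite mulrDl; apply: (le_trans (lerD q1 q2)); lra.
Qed.
End GammaFunction.

Lemma tends_shift (K : numFieldType) (u : nat -> K) (l : K) N :
  tends (fun n => u (n + N)%N) l -> tends u l.
Proof. by rewrite /tends -(cvg_shiftn N u). Qed.

Section GammaValues.
Variable R : realType.
Local Notation C := R[i].
Implicit Types (z : C).

(** The product estimate applies from an index N on, where the telescoping
    majorant is at most 1/2. *)
Lemma gamma_term_tends z : (forall k : nat, z + k%:R != 0) ->
  exists2 l, l != 0 & tends (gamma_term z) l.
Proof.
move=> hz; set A := normc z; have A0 : 0 <= A := normc_ge0 z.
pose c := 16 * A ^+ 2 + 2 * A.
have c0 : 0 <= c by rewrite /c; have := sqr_ge0 A; lra.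
have [N hN] : exists N, 2 * c + 2 * A + 1 < N%:R.
  by exists (Num.bound (2 * c + 2 * A + 1)); apply: archi_boundP; lra.
have N0 : (0 < N)%N by rewrite -(ltr0n R); lra.
have N0' : 0 < N%:R :> R by rewrite ltr0n.
pose d n : R := c * ((n + N)%:R)^-1.
have dlim : d @ \oo --> (0 : R).
  rewrite -[X in _ --> X](mulr0 c); apply: cvgMr.
  have -> : (fun n => (n + N)%:R^-1) = (fun n => harmonic (n + N.-1)) :> (nat
    -> R).
    by apply/funext => n; rewrite /harmonic /= -addnS prednK.
  by rewrite (cvg_shiftn N.-1 (@harmonic R)); exact: cvg_harmonic.
(* d n = c / (n + N) is the majorant provided by gamma_step_le, and N is so
   large that d 0 <= 1/2 and 2 |z| <= N. *)
have [] := @cvg_infinite_product R (fun n => gamma_term z (n + N))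
  (fun n => gamma_step z (n + N)) d dlim.
- by move=> n; rewrite mulr_ge0 // invr_ge0 ler0n.
- rewrite /d add0n ler_pdivrMr //; lra.
- move=> n; rewrite /d ler_wpM2l // lef_pV2 ?posrE ?ltr0n ?addn_gt0 ?N0 ?orbT
  //.
  by rewrite ler_nat leq_add2r.
- rewrite add0n /gamma_term npowcE; apply: mulf_neq0; first apply: mulf_neq0.
  + by rewrite pnatr_eq0 -lt0n fact_gt0.
  + rewrite /cexp; apply/eqP => -[/eqP + /eqP].
    rewrite !mulf_eq0 !(gt_eqF (expR_gt0 _)) /= => /eqP cos0' /eqP sin0'.
    have := cos2Dsin2 (complex.Im (z * (ln N%:R)%:C)).
    by rewrite cos0' sin0' !expr0n /= addr0 => /eqP; rewrite eq_sym oner_eq0.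
  + by rewrite invr_eq0; apply/prodf_neq0 => k _.
- by move=> n; rewrite addSn gamma_termS // addn_gt0 N0 orbT.
- move=> n; rewrite /d addSn -mulrBr; apply: gamma_step_le.
    by rewrite addn_gt0 N0 orbT.
  have : N%:R <= (n + N)%:R :> R by rewrite ler_nat leq_addl.
  by rewrite -/A; lra.
- by move=> l l0 tl; exists l => //; apply: tends_shift tl.
Qed.

Lemma Gamma_neq0 z : (forall k : nat, z + k%:R != 0) -> Gamma z != 0.
Proof. by case/gamma_term_tends => l l0 /tends_clim; rewrite GammaE => ->. Qed.

Lemma tends_ratio z : tends (fun n => n%:R / (z + n.+1%:R)) (1 : C).
Proof.
apply: tends_normc; set A := normc z; have A0 : 0 <= A := normc_ge0 z.
apply: (@squeeze_cvgr _ _ _ _ (fun=> 0) (fun n => 2 * (A + 1) * harmonic n)).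
- exists (Num.bound (2 * A)) => // n /= hn; rewrite normc_ge0 /=.
  have An : 2 * A < n%:R.
    by apply: lt_le_trans (archi_boundP _) _; rewrite ?ler_nat //; lra.
  pose D := z + n.+1%:R.
  have nD : n.+1%:R <= 2 * normc D.
    have := le_normcD D (- z); rewrite normcN.
    have -> : D + - z = n.+1%:R by rewrite /D addrAC subrr add0r.
    by rewrite normc_nat -/A -natr1; lra.
  have n1 : 0 < n.+1%:R :> R by rewrite ltr0n.
  have D0 : D != 0 by apply/eqP => D0; move: nD; rewrite D0 normc0; lra.
  have -> : 1 - n%:R / (z + n.+1%:R) = (z + 1) / D.
    by rewrite /D -natr1; field; rewrite natr1.
  have pD : 0 < normc D by lra.
  rewrite normcM normcV ler_pdivrMr // /harmonic /= mulrAC ler_pdivlMr //.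
  have z1 : normc (z + 1) <= A + 1.
    by apply: le_trans (le_normcD _ _) _; rewrite normc1.
  have := ler_pM (normc_ge0 _) (ltW n1) z1 nD; lra.
- exact: cvg_cst.
- rewrite -[X in _ --> X](mulr0 (2 * (A + 1))); apply: cvgMr.
  exact: cvg_harmonic.
Qed.

(** The terms of Euler's limit at z + 1 and at z differ by the factor
    z * n / (z + n + 1). *)
Lemma GammaS z : (forall k : nat, z + k%:R != 0) -> Gamma (z + 1) = z * Gamma z.
Proof.
move=> hz; have [l _ zl] := gamma_term_tends hz.
rewrite [in RHS]GammaE (tends_clim zl) GammaE; apply: tends_clim.
have := tendsM (tendsM zl (@tends_cst _ z)) (@tends_ratio z).
rewrite mulr1 mulrC; apply: (@tends_eventually _ _ _ _ 1%N) => n n0.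
rewrite /gamma_term.
have nn : npowc n (z + 1) = npowc n z * n%:R.
  rewrite !npowcE mulrDl mul1r cexpD; congr (_ * _).
  by rewrite /cexp /= cos0 sin0 lnK ?posrE ?ltr0n // mulr1 mulr0
    real_complex_nat.
(* Both products are the one over n + 2 consecutive factors. *)
have pE : \prod_(k < n.+1) (z + 1 + k%:R) * z = \prod_(k < n.+1) (z + k%:R) *
  (z + n.+1%:R).
  transitivity (\prod_(k < n.+2) (z + k%:R)); last by rewrite big_ord_recr.
  rewrite [RHS]big_ord_recl addr0 mulrC; congr (_ * _).
  by apply: eq_bigr => k _; rewrite /bump /= -nat1r addrA.
have z0 : z != 0 by have := hz 0%N; rewrite addr0.
have p0 : \prod_(k < n.+1) (z + k%:R) != 0 by apply/prodf_neq0 => k _.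
have -> : \prod_(k < n.+1) (z + 1 + k%:R) = \prod_(k < n.+1) (z + k%:R) * (z +
  n.+1%:R) / z.
  by rewrite -pE mulfK.
rewrite nn; field; rewrite p0 z0 /=; have := hz n.+1; rewrite -natr1.
by rewrite (addrC 1) andbT.
Qed.

Lemma Gamma1 : Gamma (1 : C) = 1.
Proof.
rewrite GammaE; apply: tends_clim.
have := @tends_ratio 0; apply: (@tends_eventually _ _ _ _ 1%N) => n n0.
rewrite add0r /gamma_term npowcE mul1r.
have -> : cexp (ln n%:R)%:C = n%:R :> C.
  by rewrite /cexp /= cos0 sin0 lnK ?posrE ?ltr0n // mulr1 mulr0
    real_complex_nat.
have -> : \prod_(k < n.+1) (1 + k%:R) = n.+1`!%:R :> C.
  elim: n {n0} => [|n IH]; first by rewrite big_ord1 addr0.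
  by rewrite big_ord_recr /= IH nat1r -natrM mulnC.
rewrite factS natrM; field.
by rewrite nat1r !pnatr_eq0 -lt0n fact_gt0.
Qed.

Lemma Gamma_nat n : Gamma (n%:R + 1 : C) = n`!%:R.
Proof.
elim: n => [|n IH]; first by rewrite add0r Gamma1.
rewrite -natr1 GammaS ?IH; first by rewrite natr1 factS natrM.
by move=> k; rewrite natr1 -natrD pnatr_eq0.
Qed.

Lemma Gamma_nonpos n : Gamma (- n%:R : C) = 0.
Proof.
rewrite GammaE; apply: tends_clim.
apply: (@tends_eventually _ _ _ _ n _ (@tends_cst _ 0)) => m nm.
rewrite /gamma_term (bigD1 (Ordinal (leq_ltn_trans nm (ltnSn m)))) //= addNr.
by rewrite mul0r invr0 mulr0.
Qed.

End GammaValues.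

(** * The operator S_2 is the shear *)

Section Exponential.
Variables (K : numFieldType) (V : lmodType K) (T : V -> V).

Lemma expopE N p : (forall k, (N <= k)%N -> iter k T p = 0) ->
  expop T p = \sum_(k < N) (k`!%:R)^-1 *: iter k T p.
Proof.
move=> h; rewrite /expop (fsbig_ord _ N (fun k => (k`!%:R)^-1 *: iter k T p)).
apply/esym/fsbig_widen => // k [_ /= /negP]; rewrite -leqNgt => /h ->.
by rewrite scaler0.
Qed.

(** Under this condition the exponential series is a finite sum at each
    vector. *)
Definition locally_nilpotent :=
  forall p, exists N, forall k, (N <= k)%N -> iter k T p = 0.

Hypothesis TL : linear T.
Hypothesis Tnil : locally_nilpotent.

Lemma iter_linear k : linear (iter k T).
Proof. by move=> a p q; elim: k => //= k ->; rewrite TL. Qed.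

Lemma expop_linear : linear (expop T).
Proof.
move=> a p q; have [N hp] := Tnil p; have [M hq] := Tnil q.
have hN k : (maxn N M <= k)%N -> (iter k T p = 0) * (iter k T q = 0).
  by rewrite geq_max => /andP[/hp -> /hq ->].
rewrite !(@expopE (maxn N M)) => [|k /hN h|k /hN h|k /hN h]; rewrite ?h //.
  rewrite scaler_sumr -big_split; apply: eq_bigr => k _ /=.
  by rewrite iter_linear scalerDr !scalerA mulrC.
by rewrite iter_linear !h scaler0 addr0.
Qed.
End Exponential.

(** For f free of the variable X_i, the exponential of f d_i substitutes
    X_i + f for X_i. *)
Section FlowOfDerivation.
Variables (K : numFieldType) (i : 'I_6) (f : {mpoly K[6]}).
Local Notation P := {mpoly K[6]}.
Hypothesis fi : f^`M(i) = 0.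
Local Notation T := (fun p : P => f * p^`M(i)).

Lemma derivation_linear : linear T.
Proof. by move=> a p q; rewrite mderivD mderivZ mulrDr -scalerAr. Qed.

Lemma iter_derivation a k (g : P) : g^`M(i) = 0 ->
  iter k T ('X_i ^+ a * g) = (a ^_ k)%:R *: (f ^+ k * ('X_i ^+ (a - k) * g)).
Proof.
move=> gi; elim: k => [|k IH];
  first by rewrite ffactn0 scale1r subn0 expr0 mul1r.
have fk : (f ^+ k)^`M(i) = 0.
  elim: (k) => [|n IHn]; first by rewrite expr0 mderiv1.
  by rewrite exprS mderivM fi IHn mul0r mulr0 addr0.
rewrite iterS IH mderivZ !mderivM fk gi mderivXexp eqxx mul0r add0r mulr0 addr0
  mul1r.
rewrite ffactnSr natrM subnS -!scalerAl -!scalerAr scalerA exprS;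
  congr (_ *: _).
ring.
Qed.

Lemma expop_derivation a (g : P) : g^`M(i) = 0 ->
  expop T ('X_i ^+ a * g) = ('X_i + f) ^+ a * g.
Proof.
move=> gi; rewrite (@expopE _ _ _ a.+1) => [|k ak]; last first.
  by rewrite iter_derivation // ffact_small // scale0r.
rewrite exprDn big_distrl; apply: eq_bigr => k _ /=.
rewrite iter_derivation // scalerA -bin_ffact natrM mulrC mulfK; last first.
  by rewrite pnatr_eq0 -lt0n fact_gt0.
by rewrite scaler_nat mulrnAl; congr (_ *+ _); ring.
Qed.

Lemma monomial_split m : exists2 g : P, g^`M(i) = 0 &
  'X_[m] = 'X_i ^+ m i * g.
Proof.
exists 'X_[m - U_(i) *+ m i].
  by rewrite mderivX mnmBE mulmnE mnm1E eqxx mul1n subnn scale0r.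
rewrite mpolyXn -mpolyXD addmC submK //; apply/mnm_lepP => k.
by rewrite mulmnE mnm1E; case: eqVneq => [->|_]; rewrite ?mul1n ?mul0n.
Qed.

Lemma derivation_nilpotent : locally_nilpotent T.
Proof.
have iterD k p q : iter k T (p + q) = iter k T p + iter k T q.
  by have := iter_linear derivation_linear k 1 p q; rewrite !scale1r.
have iterZ k al p : iter k T (al *: p) = al *: iter k T p.
  have := iter_linear derivation_linear k (-1) 0 0;
    rewrite scaler0 addr0 scaleN1r.
  by rewrite addNr => it0; rewrite -[_ *: p]addr0 (iter_linear
    derivation_linear) it0 addr0.
move=> p; elim/mon_ind: p => [a b c u j l|p q [N hp] [M hq]|al p [N hp]].
- rewrite mon_mexp; move: (mexp _ _ _ _ _ _) => m.
  have [g gi ->] := monomial_split m; exists (m i).+1 => k ek.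
  by rewrite iter_derivation // ffact_small // scale0r.
- exists (maxn N M) => k; rewrite geq_max => /andP[/hp hp' /hq hq'].
  by rewrite iterD hp' hq' addr0.
- by exists N => k /hp h; rewrite iterZ h scaler0.
Qed.

End FlowOfDerivation.

Section ShearFormula.
Variable R : realType.
Local Notation C := R[i].
Local Notation P := {mpoly R[i][6]}.

Lemma S2_mon a b c i j l : S2 (mon C a b c i j l) = shear (mon C a b c i j l).
Proof.
rewrite /S2 /=.
have -> : mon C a b c i j l =
  'X_x1 ^+ a * ('X_y1 ^+ b * 'X_z2 ^+ c * 'X_x2 ^+ i * 'X_y2 ^+ j * 'X_z1 ^+ l).
  by rewrite /mon !mulrA.
have D (k n : 'I_6) e : n != k -> ('X_n ^+ e)^`M(k) = 0 :> P.
  by move=> nk; rewrite mderivXexp (negPf nk) mul0r scale0r.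
have DX (k n : 'I_6) : n != k -> ('X_n)^`M(k) = 0 :> P.
  by move=> nk; rewrite mderivXU (negPf nk).
rewrite expop_derivation; [|by rewrite DX|
  by rewrite !mderivM !D // !(mulr0, mul0r, addr0)].
have -> : ('X_x1 + 'X_x2) ^+ a * ('X_y1 ^+ b * 'X_z2 ^+ c * 'X_x2 ^+ i *
    'X_y2 ^+ j * 'X_z1 ^+ l) = 'X_z2 ^+ c * (('X_x1 + 'X_x2) ^+ a *
    'X_y1 ^+ b * 'X_x2 ^+ i * 'X_y2 ^+ j * 'X_z1 ^+ l) :> P by ring.
have D0 (k : 'I_6) (p : P) e : p^`M(k) = 0 -> (p ^+ e)^`M(k) = 0.
  move=> p0; elim: e => [|e IH]; first by rewrite expr0 mderiv1.
  by rewrite exprS mderivM p0 IH mul0r mulr0 addr0.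
rewrite expop_derivation; [|by rewrite DX|
  by rewrite !mderivM !D // D0 ?mderivD ?DX ?addr0 // !(mulr0, mul0r, addr0)].
have -> : ('X_z2 + 'X_z1) ^+ c * (('X_x1 + 'X_x2) ^+ a *
    'X_y1 ^+ b * 'X_x2 ^+ i * 'X_y2 ^+ j * 'X_z1 ^+ l) =
   'X_y1 ^+ b * (('X_z2 + 'X_z1) ^+ c * ('X_x1 + 'X_x2) ^+ a *
      'X_x2 ^+ i * 'X_y2 ^+ j * 'X_z1 ^+ l) :> P by ring.
rewrite expop_derivation; first last.
- by rewrite !mderivM !D // !D0 ?mderivD ?DX ?addr0 // !(mulr0, mul0r, addr0).
- by rewrite mderivB mderivM !DX // !(mulr0, mul0r, addr0) subr0.
rewrite !rmorphM !rmorphXn /= !shearX addrA; ring.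
Qed.

Lemma S2E (p : P) : S2 p = shear p.
Proof.
pose E (i : 'I_6) (f : P) := expop (fun p : P => f * p^`M(i)).
have EL i f : f^`M(i) = 0 -> linear (E i f).
  by move=> fi; apply: expop_linear;
    [exact: derivation_linear | exact: derivation_nilpotent].
have S2L : linear (@S2 R).
  have e1 := EL x1 'X_x2; have e2 := EL z2 'X_z1.
  have e3 := EL y1 ('X_y2 - 'X_x1 * 'X_z1).
  have S2E u : S2 u = E y1 ('X_y2 - 'X_x1 * 'X_z1) (E z2 'X_z1 (E x1 'X_x2 u)).
    by [].
  move=> al u v; rewrite !S2E e1 ?mderivXU // e2 ?mderivXU // e3 //.
  by rewrite mderivB mderivM !mderivXU /= mulr0 mul0r addr0 subr0.
elim/mon_ind: p => [a b c i j l|p q Hp Hq|al p Hp].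
- exact: S2_mon.
- by have := S2L 1 p q; rewrite !scale1r Hp Hq raddfD.
- have S0 : S2 (0 : P) = 0.
    by have := S2L (-1) 0 0; rewrite scaler0 addr0 scaleN1r addNr.
  by rewrite -[_ *: p]addr0 S2L S0 Hp !addr0 linearZ.
Qed.

Lemma S2invE (p : P) : S2inv p = unshear p.
Proof.
have inj : {in [set: P] &, injective (@S2 R)}.
  by move=> u v _ _; rewrite !S2E; apply: can_inj (@shearK C) _ _.
have := pinvKV (fun=> 0 : P) inj; rewrite -/(@S2inv R).
move=> /(_ (unshear p)); rewrite S2E unshearK; apply.
by rewrite inE.
Qed.
End ShearFormula.

(** * Binomial sums *)

Section LinearFunctions.
Variables (K : numFieldType) (V W : lmodType K) (F : V -> W).
Hypothesis FL : linear F.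

Lemma linear_fun0 : F 0 = 0.
Proof. by have := FL (-1) 0 0; rewrite scaler0 addr0 scaleN1r addNr. Qed.

Lemma linear_funD u v : F (u + v) = F u + F v.
Proof. by have := FL 1 u v; rewrite !scale1r. Qed.

Lemma linear_funZ a u : F (a *: u) = a *: F u.
Proof. by have := FL a u 0; rewrite !addr0 linear_fun0 addr0. Qed.

Lemma linear_fun_sum (I : Type) (t : seq I) (g : I -> V) :
  F (\sum_(k <- t) g k) = \sum_(k <- t) F (g k).
Proof.
elim: t => [|k t IH]; first by rewrite !big_nil linear_fun0.
by rewrite !big_cons linear_funD IH.
Qed.
End LinearFunctions.

Section BinomialSums.
Variable K : numFieldType.

(** Pascal's rule: the (k+1)-st alternating binomial sum is the difference of
    two k-th ones. *)
Lemma binomial_difference (F : nat -> K) k :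
  \sum_(j < k.+2) 'C(k.+1, j)%:R * (-1) ^+ j * F j =
  \sum_(j < k.+1) 'C(k, j)%:R * (-1) ^+ j * F j
  - \sum_(j < k.+1) 'C(k, j)%:R * (-1) ^+ j * F j.+1.
Proof.
rewrite big_ord_recl /= bin0.
under eq_bigr => j _ do rewrite /bump /= add1n binS natrD !mulrDl.
rewrite big_split /= addrA; congr (_ + _).
  rewrite [RHS]big_ord_recl /= bin0; congr (_ + _).
  rewrite big_ord_recr /= bin_small // mul0r mul0r addr0.
  by apply: eq_bigr.
by rewrite -sumrN; apply: eq_bigr => j _; rewrite exprS; ring.
Qed.

(** Resummation along k = i + j, with C(a, j) C(a-j, k-j) = C(a, k) C(k, j). *)
Lemma binomial_double_sum (V : lmodType K) (a : nat) (g : nat -> K) (E :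
  nat -> V) :
  \sum_(j < a.+1) ('C(a, j)%:R * g j) *:
     \sum_(i < (a - j).+1) 'C(a - j, i)%:R *: E (j + i)%N =
  \sum_(k < a.+1) ('C(a, k)%:R * \sum_(j < k.+1) 'C(k, j)%:R * g j) *: E k.
Proof.
pose H j k := ('C(a, j)%:R * g j * 'C(a - j, k - j)%:R) *: E k.
transitivity (\sum_(j < a.+1) \sum_(k < a.+1 | (j <= k)%N) H j k).
  have tail (j : nat) (G : nat -> V) : (j <= a)%N ->
      \sum_(k < a.+1 | (j <= k)%N) G k = \sum_(i < (a - j).+1) G (i + j)%N.
    move=> ja; rewrite -(big_geq_mkord j a.+1 xpredT G).
    by rewrite -[in LHS](add0n j) big_addn big_mkord subSn.
  apply: eq_bigr => j _; rewrite scaler_sumr tail; last by rewrite -ltnS.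
  by apply: eq_bigr => i _; rewrite scalerA /H addnK addnC.
rewrite (exchange_big_dep xpredT) //=; apply: eq_bigr => k _.
transitivity (\sum_(j < k.+1) H j k).
  by rewrite (big_ord_widen a.+1 (fun j => H j k)) //.
rewrite mulr_sumr scaler_suml.
apply: eq_bigr => j _; rewrite /H; congr (_ *: _).
have jk : (j <= k)%N by rewrite -ltnS.
have ka : (k <= a)%N by rewrite -ltnS.
have fact_neq0 n : n`!%:R != 0 :> K by rewrite pnatr_eq0 -lt0n fact_gt0.
have bin_fac n m : (m <= n)%N ->
  'C(n, m)%:R = n`!%:R / (m`!%:R * (n - m)`!%:R) :> K.
  by move=> mn; rewrite -(bin_fact mn) natrM natrM mulfK // mulf_neq0.
have ja := leq_trans jk ka.
have e : (a - j - (k - j) = a - k)%N by rewrite subnBA // subnK.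
rewrite (bin_fac _ _ ja) (bin_fac _ _ (leq_sub2r j ka)) (bin_fac _ _ ka).
rewrite (bin_fac _ _ jk) e; field.
by rewrite !fact_neq0.
Qed.

(** The Pochhammer symbol (al)_n. *)
Definition rising (al : K) n : K := \prod_(j < n) (al + j%:R).

Lemma risingS al n : rising al n.+1 = rising al n * (al + n%:R).
Proof. by rewrite /rising big_ord_recr. Qed.

Lemma rising_ratioE al n : rising_ratio al n = rising al n / n`!%:R.
Proof.
elim: n => [|n IH]; first by rewrite /rising_ratio /rising !big_ord0 divr1.
rewrite rising_ratioS risingS IH factS natrM invfM; ring.
Qed.

Lemma rising_neq0 al n : nonint al -> rising al n != 0.
Proof. by move=> h; apply/prodf_neq0 => j _; rewrite nonint_neq0. Qed.

(** The k-th backward difference of n |-> (p+1)_n / (q+1)_n at k + n; by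
    induction on k, each difference producing one more factor q - p + k. *)
Lemma difference_of_ratio p q k n : nonint q ->
  \sum_(j < k.+1) 'C(k, j)%:R * (-1) ^+ j *
     (rising (p + 1) (k + n - j) / rising (q + 1) (k + n - j)) =
  (-1) ^+ k * rising (q - p) k * rising (p + 1) n / rising (q + 1) (k + n).
Proof.
move=> hq; have hq1 := nonintD1 hq.
elim: k n => [|k IH] n.
  by rewrite big_ord1 bin0 subn0 /rising big_ord0 !mulr1 !mul1r.
rewrite (binomial_difference
  (fun j => rising (p + 1) (k.+1 + n - j) / rising (q + 1) (k.+1 + n - j))).
have -> : (k.+1 + n = k + n.+1)%N by rewrite addSnnS.
rewrite IH; under [X in _ - X]eq_bigr => j _ do rewrite addnS subSS.
rewrite IH addnS !risingS exprS natrD; field.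
by rewrite rising_neq0 // -natrD nonint_neq0.
Qed.
End BinomialSums.

(** * The explicit formula on monomials *)

Section FormulaOnMonomials.
Variable R : realType.
Local Notation C := R[i].
Local Notation P := {mpoly R[i][6]}.
Local Notation L := {freeg lmon / R[i]}.
Implicit Types (a b i j l : nat) (c : int).

Definition lexp a b i j l : 'X_{1..5} :=
  [multinom nth 0%N [:: a; b; l; i; j] k | k < 5].

(** Laurent monomials, with the exponents in the order used for [mon]. *)
Definition lau a b c i j l : L := << (lexp a b i j l, c) : lmon >>.

Lemma freegZ (z : C) (x : lmon) : z *: << x >> = << z *g x >> :> L.
Proof. by apply/eqP/freeg_eqP => y; rewrite coeffZ !coeffU mul1r. Qed.

Lemma lau_ind (Q : L -> Prop) :
  (forall a b c i j l, Q (lau a b c i j l)) ->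
  (forall p q, Q p -> Q q -> Q (p + q)) -> (forall z p, Q p -> Q (z *: p)) ->
  forall p, Q p.
Proof.
move=> Qm QD QZ p; rewrite -(freeg_sumE p).
apply: big_ind => // [|x _]; first by rewrite -(scale0r (lau 0 0 0 0 0 0));
  apply: QZ.
rewrite -freegZ; apply: QZ; case: x => m c.
have -> : m = lexp (m (@Ordinal 5 0 isT)) (m (@Ordinal 5 1 isT))
    (m (@Ordinal 5 3 isT)) (m (@Ordinal 5 4 isT)) (m (@Ordinal 5 2 isT)).
  apply/mnmP => -[[|[|[|[|[|//]]]]] h]; rewrite mnmE /=;
    by congr (m _); apply: val_inj.
exact: Qm.
Qed.

Lemma laurentE (p : P) :
  laurent p = monlift (fun m => << laurent_mon m >> : L) p.
Proof. by rewrite monliftE; apply: eq_bigr => m _; rewrite freegZ. Qed.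

Lemma laurent_linear : linear (@laurent R).
Proof. by move=> z p q; rewrite !laurentE linearP. Qed.

Lemma laurent_monE a b (c : nat) i j l :
  laurent (mon C a b c i j l) = lau a b c i j l.
Proof.
rewrite laurentE mon_mexp monliftX /laurent_mon /lau mnmE /=;
  congr << (_, _) >>.
by apply/mnmP => -[[|[|[|[|[|//]]]]] h]; rewrite !mnmE.
Qed.

Lemma unlaurent_lau a b (c : nat) i j l :
  unlaurent (lau a b c i j l) = mon C a b c i j l.
Proof.
rewrite /unlaurent liftU scale1r mon_mexp /=; congr mpolyX.
have W (k : 'I_5) : mnmwiden (lexp a b i j l) (widen_ord (leqnSn 5) k) =
    nth 0%N [:: a; b; l; i; j] k by rewrite mnmwiden_widen mnmE.
apply/mnmP; apply: ord6P;
  rewrite mnmDE mulmnE mnm1E /= ?muln0 ?addn0 ?mul0n ?mul1n mnmE.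
- by apply: etrans (W (@Ordinal 5 0 isT)); congr (mnmwiden _ _); apply: val_inj.
- by apply: etrans (W (@Ordinal 5 1 isT)); congr (mnmwiden _ _); apply: val_inj.
- by apply: etrans (W (@Ordinal 5 2 isT)); congr (mnmwiden _ _); apply: val_inj.
- by apply: etrans (W (@Ordinal 5 3 isT)); congr (mnmwiden _ _); apply: val_inj.
- by apply: etrans (W (@Ordinal 5 4 isT)); congr (mnmwiden _ _); apply: val_inj.
- have -> : z2 = ord_max by apply: val_inj.
  by rewrite mnmwiden_ordmax.
Qed.

Lemma y1z2_dx1_lau a b c i j l :
  y1z2_dx1 (lau a b c i j l) = a%:R *: lau a.-1 b.+1 (c - 1) i j l.
Proof.
rewrite /y1z2_dx1 liftU scale1r /= mnmE /=; congr (_ *: << (_, _) >>).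
apply/mnmP => k; rewrite mnmDE mnmBE !mnm1E !mnmE.
by case: k => [[|[|[|[|[|//]]]]] h]; rewrite /= ?subn0 ?addn0 ?subn1 ?addn1.
Qed.

Lemma fun_x1dx1_lau f a b c i j l :
  fun_x1dx1 f (lau a b c i j l) = f a%:R *: lau a b c i j l.
Proof. by rewrite /fun_x1dx1 liftU scale1r /= mnmE. Qed.

Lemma fun_z2dz2_lau f a b c i j l :
  fun_z2dz2 f (lau a b c i j l) = f c%:~R *: lau a b c i j l.
Proof. by rewrite /fun_z2dz2 liftU scale1r. Qed.

Variable e : C.
(** One name for the two exponents (e = 1 and e = - 1) of the formula. *)
Definition ydx (q : L) : L := e *: y1z2_dx1 q.

Lemma ydx_linear : linear ydx.
Proof.
by move=> z p q; rewrite /ydx /y1z2_dx1 fglift_is_linear scalerDr !scalerA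
  mulrC.
Qed.

Lemma iter_ydx k a b c i j l : iter k ydx (lau a b c i j l) =
  (e ^+ k * (a ^_ k)%:R) *: lau (a - k) (b + k) (c - k%:Z) i j l.
Proof.
elim: k => [|k IH]; first by rewrite ffactn0 expr0 mul1r scale1r subn0 addn0
  subr0.
rewrite iterS IH (linear_funZ ydx_linear) /ydx y1z2_dx1_lau !scalerA.
rewrite exprS ffactnSr natrM -subnS -addnS; congr (_ *: lau _ _ _ _ _ _).
  ring.
by rewrite -addn1 PoszD opprD addrA.
Qed.

Lemma expop_ydx a b c i j l : expop ydx (lau a b c i j l) =
  \sum_(k < a.+1) ('C(a, k)%:R * e ^+ k) *:
     lau (a - k) (b + k) (c - k%:Z) i j l.
Proof.
rewrite (@expopE _ _ _ a.+1) => [|k ak]; last first.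
  by rewrite iter_ydx ffact_small // mulr0 scale0r.
apply: eq_bigr => k _; rewrite iter_ydx scalerA; congr (_ *: _).
rewrite -bin_ffact natrM; field.
by rewrite pnatr_eq0 -lt0n fact_gt0.
Qed.

Lemma ydx_nilpotent : locally_nilpotent ydx.
Proof.
move=> p; elim/lau_ind: p => [a b c i j l|p q [N hp] [M hq]|al p [N hp]].
- exists a.+1 => k ak.
  by rewrite iter_ydx ffact_small // mulr0 scale0r.
- exists (maxn N M) => k; rewrite geq_max => /andP[/hp hp' /hq hq'].
  by rewrite (linear_funD (iter_linear ydx_linear k)) hp' hq' addr0.
- exists N => k /hp h.
  by rewrite (linear_funZ (iter_linear ydx_linear k)) h scaler0.
Qed.

End FormulaOnMonomials.

Section FormulaIsCore.
Variable R : realType.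
Local Notation C := R[i].
Local Notation P := {mpoly R[i][6]}.

Lemma Gamma_rising (al : C) n : nonint al ->
  Gamma (al + n%:R) = Gamma al * rising al n.
Proof.
move=> h; elim: n => [|n IH]; first by rewrite addr0 /rising big_ord0 mulr1.
rewrite risingS -natr1 addrA GammaS ?IH; first by ring.
by move=> k; rewrite -addrA -natrD nonint_neq0.
Qed.

Lemma Gamma_nonint_neq0 (al : C) : nonint al -> Gamma al != 0.
Proof. by move=> h; apply: Gamma_neq0 => k; apply: nonint_neq0. Qed.

Variables u1 u2 v2 v3 : C.
Let p := u1 - v2.
Let q := u1 - u2.
Let r := v2 - v3.
Let s := u2 - v3.
Hypotheses (hp : nonint p) (hq : nonint q) (hr : nonint r) (hs : nonint s).

(** The value of the formula at 1. *)
Definition Gamma_norm : C :=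
  Gamma (p + 1) * Gamma (s + 1) / (Gamma (q + 1) * Gamma (r + 1)).

Lemma Gamma_norm_neq0 : Gamma_norm != 0.
Proof.
by rewrite mulf_neq0 ?invr_eq0 ?mulf_neq0 // Gamma_nonint_neq0 //;
  apply: nonintD1.
Qed.

Local Notation G2 := (fun t : C => Gamma (t + u2 - v3 + 1) / Gamma (t + 1)).
Local Notation F := (fun t :
  C => Gamma (t + u1 - v2 + 1) / Gamma (t + u1 - u2 + 1)).
Local Notation G1 := (fun t : C => Gamma (t + 1) / Gamma (t + v2 - v3 + 1)).

(** The formula without the outer factors S_2 and its inverse. *)
Definition formula_core : P -> P :=
  @unlaurent R \o fun_z2dz2 G2 \o expop (@y1z2_dx1 R) \o fun_x1dx1 F
  \o expop (fun q => - y1z2_dx1 q) \o fun_z2dz2 G1 \o @laurent R.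

Lemma formula_core_linear : linear formula_core.
Proof.
have e1 : @y1z2_dx1 R = ydx 1 by apply/funext => z; rewrite /ydx scale1r.
have e2 : (fun q => - @y1z2_dx1 R q) = ydx (-1).
  by apply/funext => z; rewrite /ydx scaleN1r.
rewrite /formula_core e2 e1 => z f g /=.
rewrite laurent_linear /fun_z2dz2 /fun_x1dx1 /unlaurent !fglift_is_linear.
rewrite (expop_linear (ydx_linear _) (@ydx_nilpotent _ _)) !fglift_is_linear.
by rewrite (expop_linear (ydx_linear _) (@ydx_nilpotent _ _)) !fglift_is_linear.
Qed.

Lemma G1E n : G1 n%:R = n`!%:R / (Gamma (r + 1) * rising (r + 1) n).
Proof.
rewrite /= Gamma_nat; congr (_ / _).
by rewrite -Gamma_rising; [congr Gamma; rewrite /r; ring | apply: nonintD1].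
Qed.

Lemma FE n : F n%:R =
  Gamma (p + 1) / Gamma (q + 1) * (rising (p + 1) n / rising (q + 1) n).
Proof.
rewrite /=; have -> : n%:R + u1 - v2 + 1 = p + 1 + n%:R by rewrite /p; ring.
have -> : n%:R + u1 - u2 + 1 = q + 1 + n%:R by rewrite /q; ring.
by rewrite !Gamma_rising; [rewrite invfM;
  ring | apply: nonintD1 | apply: nonintD1].
Qed.

Lemma G2E n : G2 n%:R = Gamma (s + 1) * rising (s + 1) n / n`!%:R.
Proof.
rewrite /= Gamma_nat; congr (_ / _).
by rewrite -Gamma_rising; [congr Gamma; rewrite /s; ring | apply: nonintD1].
Qed.

Lemma G2_neg n : G2 (Negz n)%:~R = 0.
Proof.
rewrite /=; have -> : (Negz n)%:~R + 1 = - n%:R :> C.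
  by rewrite NegzE mulrNz -pmulrn -natr1 opprD addrNK.
by rewrite Gamma_nonpos invr0 mulr0.
Qed.

(** The right exponential lowers the exponents by some j with sign (-1)^j, the
    left one by some further i; E k is the monomial reached for k = i + j, with
    the left quotient of Gamma functions applied.  The factors with nonpositive
    argument in 1 / Gamma kill E k for k > c, in accordance with [coef]. *)
Lemma formula_core_mon a b c i j l :
  formula_core (mon C a b c i j l) =
    Gamma_norm *: core p q r s (mon C a b c i j l).
Proof.
have e1 : @y1z2_dx1 R = ydx 1 by apply/funext => z; rewrite /ydx scale1r.
have e2 : (fun q => - @y1z2_dx1 R q) = ydx (-1).
  by apply/funext => z; rewrite /ydx scaleN1r.
have EL (e : C) : linear (expop (ydx e)).
  exact: expop_linear (ydx_linear e) (@ydx_nilpotent R e).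
have uL : linear (@unlaurent R) by exact: fglift_is_linear.
have zL f : linear (@fun_z2dz2 R f) by exact: fglift_is_linear.
have xL f : linear (@fun_x1dx1 R f) by exact: fglift_is_linear.
(* The powers of z2 are Laurent powers until the left Gamma quotient, which
   vanishes at the negative ones, has been applied. *)
pose E k := unlaurent (fun_z2dz2 G2 (lau R (a - k) (b + k) (c%:Z - k%:Z) i j
  l)).
have EE k : E k = if (k <= c)%N then
    (Gamma (s + 1) * rising (s + 1) (c - k) / (c - k)`!%:R) *:
    mon C (a - k) (b + k) (c - k) i j l else 0.
  rewrite /E fun_z2dz2_lau (linear_funZ uL).
  case: leqP => [kc|ck].
    rewrite subzn // unlaurent_lau; congr (_ *: _).
    by rewrite -pmulrn G2E.
  have -> : c%:Z - k%:Z = Negz (k - c).-1.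
    by rewrite NegzE prednK ?subn_gt0 // -subzn 1?ltnW // opprB.
  by rewrite G2_neg scale0r.
have -> : formula_core (mon C a b c i j l) = G1 c%:R *:
    \sum_(j0 < a.+1) ('C(a, j0)%:R * ((-1) ^+ j0 * F (a - j0)%:R)) *:
      \sum_(i0 < (a - j0).+1) 'C(a - j0, i0)%:R *: E (j0 + i0)%N.
  rewrite /formula_core e2 e1 /= laurent_monE fun_z2dz2_lau.
  rewrite (linear_funZ (EL _)) (linear_funZ (xL _)) (linear_funZ (EL _)).
  rewrite (linear_funZ (zL _)) (linear_funZ uL) expop_ydx; congr (_ *: _).
  rewrite (linear_fun_sum (xL _)) (linear_fun_sum (EL _)) (linear_fun_sum (zL
    _)).
  rewrite (linear_fun_sum uL); apply: eq_bigr => j0 _.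
  rewrite (linear_funZ (xL _)) (linear_funZ (EL _)) (linear_funZ (zL _)).
  rewrite (linear_funZ uL) fun_x1dx1_lau (linear_funZ (EL _)) (linear_funZ (zL
    _)).
  rewrite (linear_funZ uL) expop_ydx scalerA -mulrA; congr (_ *: _).
  rewrite (linear_fun_sum (zL _)) (linear_fun_sum uL); apply: eq_bigr => i0 _.
  rewrite (linear_funZ (zL _)) (linear_funZ uL) expr1n mulr1 /E.
  by rewrite subnDA addnA PoszD opprD addrA.
rewrite (binomial_double_sum a (fun j0 => (-1) ^+ j0 * F (a - j0)%:R) E).
rewrite (@core_mon _ _ _ _ _ a.+1) // !scaler_sumr; apply: eq_bigr => k _.
have ka : (k <= a)%N by rewrite -ltnS.
rewrite EE /coef ka /=; case: leqP => [kc|_]; last by rewrite scale0r !scaler0.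
rewrite !scalerA; congr (_ *: _).
have -> : \sum_(j0 < k.+1) 'C(k, j0)%:R * ((-1) ^+ j0 * F (a - j0)%:R) =
   Gamma (p + 1) / Gamma (q + 1) *
   ((-1) ^+ k * rising (q - p) k * rising (p + 1) (a - k) / rising (q + 1) a).
  have := difference_of_ratio p k (a - k) hq; rewrite subnKC // => <-.
  by rewrite mulr_sumr; apply: eq_bigr => j0 _; rewrite FE; ring.
rewrite G1E !rising_ratioE -(bin_fact ka) /Gamma_norm !natrM; field.
rewrite !pnatr_eq0 -!lt0n !fact_gt0 bin_gt0 ka !rising_neq0 //=;
  try exact: nonintD1.
by rewrite !Gamma_nonint_neq0 //; apply: nonintD1.
Qed.

Lemma formula_coreE (f : P) : formula_core f = Gamma_norm *: core p q r s f.
Proof.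
have mL := formula_core_linear;
  elim/mon_ind: f => [a b c i j l|f g Hf Hg|z f Hf].
- exact: formula_core_mon.
- by rewrite (linear_funD mL) Hf Hg raddfD scalerDr.
- have TZ : core p q r s (z *: f) = z *: core p q r s f by exact: linearZ.
  by rewrite (linear_funZ mL) Hf TZ !scalerA mulrC.
Qed.

Lemma R2formulaE (f : P) :
  R2formula u1 u2 v2 v3 f = Gamma_norm *: unshear (core p q r s (shear f)).
Proof.
have uZ z (g : P) : unshear (z *: g) = z *: unshear g by exact: linearZ.
by rewrite -uZ -formula_coreE -S2E -S2invE.
Qed.

End FormulaIsCore.

(** * Solutions of the defining equations *)

Section Assembly.
Variable R : realType.
Local Notation C := R[i].
Local Notation P := {mpoly R[i][6]}.
Local Notation P3 := (P * P * P)%type.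
Local Notation DM := (fun (i : 'I_6) (p : P) => p^`M(i)).
Local Notation XM := (fun i : 'I_6 => 'X_i : P).
Local Notation lax := (lax DM XM).

(** Matrices with operator entries are handled through their action on triples
    of polynomials. *)
Definition pick3 (i : 'I_3) (v : P3) : P := nth 0 [:: v.1.1; v.1.2; v.2] i.

Definition unit3 (j : 'I_3) (p : P) : P3 :=
  ((j == 0 :> nat)%:R * p, (j == 1 :> nat)%:R * p, (j == 2 :> nat)%:R * p).

Lemma sum_ord3 (F : 'I_3 -> P) : \sum_i F i =
  F (@Ordinal 3 0 isT) + F (@Ordinal 3 1 isT) + F (@Ordinal 3 2 isT).
Proof.
rewrite 3!big_ord_recr big_ord0 /= add0r.
by do ![congr (_ + _)]; congr F; apply: val_inj.
Qed.

Lemma Lax_apply x y z (a1 a2 a3 : C) i (v : P3) :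
  \sum_k Lax x y z a1 a2 a3 i k (pick3 k v) = pick3 i (lax x y z a1 a2 a3 v).
Proof.
case: v => [[f g] h]; rewrite sum_ord3 /Lax !mxE !sum_ord3 !mxE !sum_ord3 !mxE.
rewrite /pick3; case: i => [[|[|[|//]]] hi] /=;
  move: ('X_x * f) (('X_y + 'X_x * 'X_z) * f) ('X_z * g) => F1 F2 F3;
  rewrite ?mderivD ?mderiv0 -!mul_mpolyC.
- move: (F1^`M(x)) (F1^`M(y)) (F2^`M(y)) (F3^`M(y)) (g^`M(x)) (g^`M(y))
    (h^`M(y)) => *; ring.
- move: (F1^`M(x)) (F1^`M(y)) (F2^`M(y)) (F2^`M(z)) (F3^`M(y)) (F3^`M(z))
    (g^`M(x)) (g^`M(y)) (h^`M(y)) (h^`M(z)) => *; ring.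
- move: (F1^`M(x)) (F1^`M(y)) (F2^`M(y)) (F2^`M(z)) (F3^`M(y)) (F3^`M(z))
    (g^`M(x)) (g^`M(y)) (h^`M(y)) (h^`M(z)) => *; ring.
Qed.

Lemma Lax_entry x y z (a1 a2 a3 : C) i j (p : P) :
  Lax x y z a1 a2 a3 i j p = pick3 i (lax x y z a1 a2 a3 (unit3 j p)).
Proof.
have L0 k : Lax x y z a1 a2 a3 i k 0 = 0.
  rewrite /Lax !mxE !sum_ord3 !mxE !sum_ord3 !mxE.
  case: i k => [[|[|[|//]]] hi] [[|[|[|//]]] hk] /=;
  by do ?[rewrite mulr0 | rewrite mderiv0 | rewrite scaler0 | rewrite subr0
     | rewrite addr0].
rewrite -Lax_apply (bigD1 j) //= big1 ?addr0 => [|k kj].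
  by congr (Lax _ _ _ _ _ _ _ _ _); case: j => [[|[|[|//]]] hj];
    rewrite /pick3 /= mul1r.
rewrite -[RHS](L0 k); congr (Lax _ _ _ _ _ _ _ _ _).
by case: j k kj => [[|[|[|//]]] hj] [[|[|[|//]]] hk] //= _;
  rewrite /pick3 /= mul0r.
Qed.

Lemma opmx_mulE x y z a1 a2 a3 x' y' z' b1 b2 b3 i j (p : P) :
  opmx_mul (Lax x y z a1 a2 a3) (Lax x' y' z' b1 b2 b3) i j p =
  pick3 i (lax x y z a1 a2 a3 (lax x' y' z' b1 b2 b3 (unit3 j p))).
Proof.
rewrite mxE -Lax_apply; apply: eq_bigr => k _; congr (Lax _ _ _ _ _ _ _ _ _).
exact: Lax_entry.
Qed.

Lemma solves_apply (F : P -> P) x y z a1 a2 a3 x' y' z' a1' a2' a3'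
    b1 b2 b3 b1' b2' b3' i j p :
  op_opmx F (opmx_mul (Lax x y z a1 a2 a3) (Lax x' y' z' a1' a2' a3')) =
  opmx_op (opmx_mul (Lax x y z b1 b2 b3) (Lax x' y' z' b1' b2' b3')) F ->
  F (pick3 i (lax x y z a1 a2 a3 (lax x' y' z' a1' a2' a3' (unit3 j p)))) =
  pick3 i (lax x y z b1 b2 b3 (lax x' y' z' b1' b2' b3' (unit3 j (F p)))).
Proof.
move=> /matrixP/(_ i j); rewrite [LHS]mxE [RHS]mxE.
by move=> /(congr1 (fun G => G p)) /=; rewrite opmx_mulE opmx_mulE.
Qed.

Lemma nonint_generic u1 u2 u3 v1 v2 v3 : generic u1 u2 u3 v1 v2 v3 ->
  [/\ nonint (u1 - v2), nonint (u1 - u2),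
    nonint (v2 - v3) & nonint (u2 - v3 : C)].
Proof.
move=> g; split=> n.
- exact: (g (@Ordinal 6 0 isT) (@Ordinal 6 4 isT)).
- exact: (g (@Ordinal 6 0 isT) (@Ordinal 6 1 isT)).
- exact: (g (@Ordinal 6 4 isT) (@Ordinal 6 5 isT)).
- exact: (g (@Ordinal 6 1 isT) (@Ordinal 6 5 isT)).
Qed.

(** Integral shifts do not affect genericity; this is why the equations with
    l, m, n are available to a translation invariant solution. *)
Lemma generic_shift u1 u2 u3 v1 v2 v3 (l m n : nat) :
  generic u1 u2 u3 v1 v2 v3 ->
  generic (u1 + l%:R) (u2 + l%:R) (u3 + l%:R + m%:R)
    (v1 + l%:R + n%:R) (v2 + l%:R) (v3 + l%:R : C).
Proof.
move=> g w i j ij k; rewrite {}/w.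
(* e lists the integral displacements of the six parameters. *)
pose e : 'I_6 -> int := fun i => nth 0 [:: l%:Z; l%:Z; (l + m)%:Z; (l + n)%:Z;
  l%:Z; l%:Z] i.
have tE (h : 'I_6) : tnth [tuple u1 + l%:R; u2 + l%:R; u3 + l%:R + m%:R;
    v1 + l%:R + n%:R; v2 + l%:R; v3 + l%:R] h =
    tnth [tuple u1; u2; u3; v1; v2; v3] h + (e h)%:~R.
  by elim/ord6P: h; rewrite !(tnth_nth 0) /e /= -?pmulrn ?natrD ?addrA.
rewrite !tE; have := g i j ij (k - e i + e j); apply: contra => /eqP h.
by rewrite intrD intrB -h; apply/eqP; ring.
Qed.

(** The normalized solution, which sends 1 to 1. *)
Definition R2op (u1 u2 v2 v3 : C) : {linear P -> P} :=
  @unshear C \o (core (u1 - v2) (u1 - u2) (v2 - v3) (u2 - v3) \o @shear C).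

Lemma R2opE u1 u2 v2 v3 p : R2op u1 u2 v2 v3 p =
  unshear (core (u1 - v2) (u1 - u2) (v2 - v3) (u2 - v3) (shear p)).
Proof. by []. Qed.

Let shearE : (forall p q : P, shear (p + q) = shear p + shear q) *
  (forall p q : P, shear (p * q) = shear p * shear q) *
  (forall p : P, shear (- p) = - shear p) *
  (forall a (p : P), shear (a *: p) = a *: shear p) *
  (shear (0 : P) = 0) * (shear (1 : P) = 1).
Proof.
do ![split]; try by move=> *; rewrite ?rmorphD ?rmorphM ?rmorphN ?rmorph0
  ?rmorph1.
by move=> a p; rewrite /shear comp_mpolyZ.
Qed.

Lemma pick3_map (F : P -> P) i (v : P3) : pick3 i (map3 F v) = F (pick3 i v).
Proof. by case: i => [[|[|[|//]]] hi]. Qed.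

Lemma map3_unit3 (F : P -> P) j p : F 0 = 0 ->
  map3 F (unit3 j p) = unit3 j (F p).
Proof.
by move=> F0; case: j => [[|[|[|//]]] hj];
  rewrite /map3 /unit3 /= !mul0r !mul1r F0.
Qed.

Lemma R2op_solves : solves_defining_equations R2op.
Proof.
move=> u1 u2 u3 v1 v2 v3 g; have [hp hq hr hs] := nonint_generic g.
have e : u2 - v3 = v2 - v3 + (u1 - v2 - (u1 - u2)) by ring.
have HT := core_satisfies hq hr e (erefl _) (erefl _) (erefl _) (erefl _).
have HM f :
    core (u1 - v2) (u1 - u2) (v2 - v3) (u2 - v3) (opM DM XM (u1 - v3 + 2) f) =
    opM DM XM (u1 - v3 + 2) (core (u1 - v2) (u1 - u2) (v2 - v3) (u2 - v3) f).
  have -> : u1 - v3 + 2 = u1 - v2 + (v2 - v3) + 2 by ring.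
  exact: core_opM.
have key := intw_lax (mpoly_partials C) shearE (@shearX C) (@shear_deriv C)
  (@shearK C) (@unshearK C) HT HM u3 v1.
apply/matrixP => i j; rewrite [LHS]mxE [RHS]mxE; apply/funext => p /=.
rewrite !opmx_mulE.
rewrite -(map3_unit3 (F := R2op u1 u2 v2 v3)) ?raddf0 //.
rewrite -[LHS](pick3_map (R2op u1 u2 v2 v3)).
exact: (congr1 (pick3 i) (key (unit3 j p))).
Qed.

Lemma R2op_1 u1 u2 v2 v3 : R2op u1 u2 v2 v3 1 = 1.
Proof. by rewrite R2opE rmorph1 core1 rmorph1. Qed.

Lemma P3_sum_units (v : P3) : v = unit3 (@Ordinal 3 0 isT) v.1.1 +
  unit3 (@Ordinal 3 1 isT) v.1.2 + unit3 (@Ordinal 3 2 isT) v.2.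
Proof.
by case: v => [[f g] h]; congr (_, _, _);
  rewrite /= ?mul1r ?mul0r ?addr0 ?add0r.
Qed.

Lemma P3_additive_ext (F G : P3 -> P3) :
  {morph F : v w / v + w} -> {morph G : v w / v + w} ->
  (forall j p, F (unit3 j p) = G (unit3 j p)) -> F =1 G.
Proof. by move=> FD GD FG v; rewrite (P3_sum_units v) !FD !GD !FG. Qed.

Lemma pick3_inj (v w : P3) : (forall i, pick3 i v = pick3 i w) -> v = w.
Proof.
case: v w => [[f g] h] [[f' g'] h'] e.
by congr (_, _, _); [exact: (e (@Ordinal 3 0 isT))
  | exact: (e (@Ordinal 3 1 isT)) | exact: (e (@Ordinal 3 2 isT))].
Qed.

Section UniquenessOfSolution.
Variables (R2' : opfamily R) (HI : translation_invariant R2')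
  (HS : solves_defining_equations R2').
Variables u1 u2 u3 v1 v2 v3 : C.
Hypothesis g : generic u1 u2 u3 v1 v2 v3.

Let T' (p : P) : P := shear (R2' u1 u2 v2 v3 (unshear p)).

(** Translation invariance replaces the operator at the shifted parameters by
    the one at the original parameters; the shifts m and n of u3 and v1 leave
    it alone because the family does not see these parameters. *)
Lemma solution_lax (l m n : bool) (v : P3) :
  map3 (R2' u1 u2 v2 v3)
    (lax x1 y1 z1 (u1 + l%:R) (u2 + l%:R) (u3 + l%:R + m%:R)
      (lax x2 y2 z2 (v1 + l%:R + n%:R) (v2 + l%:R) (v3 + l%:R) v)) =
  lax x1 y1 z1 (u1 + l%:R) (v2 + l%:R) (u3 + l%:R + m%:R)
    (lax x2 y2 z2 (v1 + l%:R + n%:R) (u2 + l%:R) (v3 + l%:R)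
      (map3 (R2' u1 u2 v2 v3) v)).
Proof.
pose F w := map3 (R2' u1 u2 v2 v3)
    (lax x1 y1 z1 (u1 + l%:R) (u2 + l%:R) (u3 + l%:R + m%:R)
      (lax x2 y2 z2 (v1 + l%:R + n%:R) (v2 + l%:R) (v3 + l%:R) w)).
pose G w := lax x1 y1 z1 (u1 + l%:R) (v2 + l%:R) (u3 + l%:R + m%:R)
    (lax x2 y2 z2 (v1 + l%:R + n%:R) (u2 + l%:R) (v3 + l%:R)
      (map3 (R2' u1 u2 v2 v3) w)).
have FG j p : F (unit3 j p) = G (unit3 j p).
  rewrite /F /G.
  apply: pick3_inj => i; rewrite pick3_map.
  rewrite map3_unit3 ?raddf0 //.
  apply: (etrans (HI g l%:R _)).
  apply: (etrans (solves_apply i j p (HS (generic_shift l m n g)))).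
  exact: (congr1 (fun q => pick3 i (lax _ _ _ _ _ _ (lax _ _ _ _ _ _ (unit3 j
    q))))
    (esym (HI g l%:R p))).
have RD (w w' : P3) : map3 (R2' u1 u2 v2 v3) (w + w') =
    map3 (R2' u1 u2 v2 v3) w + map3 (R2' u1 u2 v2 v3) w'.
  by rewrite /map3 /= !raddfD.
have lD := laxD (mpoly_partials C).
apply: (@P3_additive_ext F G _ _ FG v) => w w'; rewrite /F /G.
- by rewrite (lD _ _ _ _ _ _ w w') lD RD.
- by rewrite RD (lD _ _ _ _ _ _ (map3 _ w) (map3 _ w')) lD.
Qed.

Lemma solution_core_relations : core_relations DM XM u1 u2 v2 v3 T'.
Proof.
apply: (@core_relations_from_shifts C P DM XM (mpoly_partials C) u1 u2 u3 v1 v2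
  v3).
- by move=> p q; rewrite /T' !raddfD.
- by move=> a p; rewrite /T' !linearZ.
move=> l m n; exact: (lax12_conj (mpoly_partials C) shearE (@shearX C)
  (@shear_deriv C) (@shearK C) (@unshearK C) (solution_lax l m n)).
Qed.

Lemma solution_scalar (p : P) :
  R2' u1 u2 v2 v3 p =
  (shear (R2' u1 u2 v2 v3 1))@_0 *: R2op u1 u2 v2 v3 p.
Proof.
have [hp hq hr hs] := nonint_generic g.
have e : u2 - v3 = v2 - v3 + (u1 - v2 - (u1 - u2)) by ring.
have HT := core_satisfies hq hr e (erefl _) (erefl _) (erefl _) (erefl _).
have HT' := solution_core_relations.
have T'1 : T' 1 = (shear (R2' u1 u2 v2 v3 1))@_0 *:
    core (u1 - v2) (u1 - u2) (v2 - v3) (u2 - v3) 1.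
  rewrite (core_relations_1 HT') core1 /T' rmorph1.
  by rewrite -mul_mpolyC mulr1.
have := core_relations_unique hq hr HT HT' T'1 (shear p).
rewrite /T' shearK => /(congr1 (@unshear C)); rewrite shearK => ->.
exact: linearZ.
Qed.
End UniquenessOfSolution.

End Assembly.

Theorem proposition5 (R : realType) :
  exists R2 : opfamily R,
    [/\ translation_invariant R2 /\ solves_defining_equations R2,
        (forall u1 u2 u3 v1 v2 v3 : R[i], generic u1 u2 u3 v1 v2 v3 ->
           exists p : {mpoly R[i][6]}, R2 u1 u2 v2 v3 p != 0),
        (forall R2' : opfamily R,
           translation_invariant R2' -> solves_defining_equations R2' ->
           exists c : R[i] -> R[i] -> R[i] -> R[i] -> R[i],
           forall u1 u2 u3 v1 v2 v3 : R[i], generic u1 u2 u3 v1 v2 v3 ->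
           forall p : {mpoly R[i][6]},
             R2' u1 u2 v2 v3 p = c u1 u2 v2 v3 *: R2 u1 u2 v2 v3 p) &
        (exists c : R[i] -> R[i] -> R[i] -> R[i] -> R[i],
           forall u1 u2 u3 v1 v2 v3 : R[i], generic u1 u2 u3 v1 v2 v3 ->
             c u1 u2 v2 v3 != 0 /\
             forall p : {mpoly R[i][6]},
               R2 u1 u2 v2 v3 p
               = c u1 u2 v2 v3 *: R2formula u1 u2 v2 v3 p)].
Proof.
exists (@R2op R); split.
- split; last exact: R2op_solves.
  move=> u1 u2 u3 v1 v2 v3 _ lam p.
  have sub (a b : R[i]) : a + lam - (b + lam) = a - b by ring.
  by rewrite [LHS]R2opE [RHS]R2opE (sub u1 v2) (sub u1 u2) (sub v2 v3) (sub u2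
    v3).
- by move=> u1 u2 u3 v1 v2 v3 _; exists 1; rewrite R2op_1 oner_neq0.
- move=> R2' HI HS.
  exists (fun u1 u2 v2 v3 => (shear (R2' u1 u2 v2 v3 1))@_0).
  by move=> u1 u2 u3 v1 v2 v3 g p; apply: (solution_scalar HI HS g).
- exists (fun u1 u2 v2 v3 => (Gamma_norm u1 u2 v2 v3)^-1).
  move=> u1 u2 u3 v1 v2 v3 g; have [hp hq hr hs] := nonint_generic g.
  have c0 := Gamma_norm_neq0 hp hq hr hs.
  split=> [|p]; first by rewrite invr_eq0.
  by rewrite R2formulaE // scalerA mulVf // scale1r.
Qed.
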